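(* Let $(\Omega,\mathscr H,\hat{\mathbb E})$ be a sub-linear expectation space, let $\mathscr H_{n,0}\subset\cdots\subset\mathscr H_{n,k_n}$ be subspaces of $\mathscr H$ and $\hat{\mathbb E}_{n,k}=\hat{\mathbb E}[\,\cdot\,|\mathscr H_{n,k}]$, $k=0,\dots,k_n$, be conditional expectation operators satisfying properties (a) and (b) of the context. Let $Z_{n,k}\in\mathscr H_{n,k}$, $k=1,\dots,k_n$, and suppose that $\{Z_{n,k}\}$ is a set of bounded random variables. Set $S_0=0$, $S_k=\sum_{i=1}^kZ_{n,i}$. Then $$\hat{\mathbb E}\Big[\Big(\max_{k\le k_n}(S_{k_n}-S_k)\Big)^2\Big]\le\hat{\mathbb E}\Big[\sum_{k=1}^{k_n}\hat{\mathbb E}[Z_{n,k}^2|\mathscr H_{n,k-1}]\Big]$$ when $\hat{\mathbb E}[Z_{n,k}|\mathscr H_{n,k-1}]\le0$ in $L_1$, $k=1,\dots,k_n$; and in general (without this sign condition), $$\hat{\mathbb E}\Big[\max_{k\le k_n}|S_k|^2\Big]\le256\left\{\hat{\mathbb E}\Big[\sum_{k=1}^{k_n}\hat{\mathbb E}[Z_{n,k}^2|\mathscr H_{n,k-1}]\Big]+\hat{\mathbb E}\left[\Big\{\sum_{k=1}^{k_n}\Big(\big(\hat{\mathbb E}[Z_{n,k}|\mathscr H_{n,k-1}]\big)^++\big(\hat{\mathcal E}[Z_{n,k}|\mathscr H_{n,k-1}]\big)^-\Big)\Big\}^2\right]\right\}.$$ Moreover, for $p\ge2$ there is a constant $C_p$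 (depending only on $p$) such that $$\hat{\mathbb E}\Big[\max_{k\le k_n}|S_k|^p\Big]\le C_p\left\{\hat{\mathbb E}\Big[\sum_{k=1}^{k_n}\hat{\mathbb E}[|Z_{n,k}|^p|\mathscr H_{n,k-1}]\Big]+\hat{\mathbb E}\Big[\Big(\sum_{k=1}^{k_n}\hat{\mathbb E}[Z_{n,k}^2|\mathscr H_{n,k-1}]\Big)^{p/2}\Big]+\hat{\mathbb E}\left[\Big\{\sum_{k=1}^{k_n}\Big(\big(\hat{\mathbb E}[Z_{n,k}|\mathscr H_{n,k-1}]\big)^++\big(\hat{\mathcal E}[Z_{n,k}|\mathscr H_{n,k-1}]\big)^-\Big)\Big\}^p\right]\right\}.$$
   Context: Sub-linear expectation space: Let $(\Omega,\mathcal F)$ be a measurable space and $\mathscr H$ a linear space of real functions on $(\Omega,\mathcal F)$ (called random variables) such that $X_1,\dots,X_n\in\mathscr H$ implies $\varphi(X_1,\dots,X_n)\in\mathscr H$ for each $\varphi\in C_{l,Lip}(\mathbb R^n)$. Here $C_{l,Lip}(\mathbb R^n)$ is the space of functions satisfying $|\varphi(x)-\varphi(y)|\le C(1+|x|^m+|y|^m)|x-y|$ for all $x,y\in\mathbb R^n$, for some $C>0$, $m\in\mathbb N$ depending on $\varphi$. A sub-linear expectation is a function $\hat{\mathbb E}:\mathscr H\to[-\infty,\infty]$ such that for all $X,Y\in\mathscr H$: (1) $X\ge Y$ implies $\hat{\mathbb E}[X]\ge\hat{\mathbb E}[Y]$; (2) $\hat{\mathbb E}[c]=c$ for constants $c$;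 (3) $\hat{\mathbb E}[X+Y]\le\hat{\mathbb E}[X]+\hat{\mathbb E}[Y]$ whenever the right side is not of the form $+\infty-\infty$ or $-\infty+\infty$; (4) $\hat{\mathbb E}[\lambda X]=\lambda\hat{\mathbb E}[X]$ for $\lambda\ge0$. If a function $X$ on $\Omega$ is not in $\mathscr H$, $\hat{\mathbb E}[X]$ denotes $\inf\{\hat{\mathbb E}[Y]:X\le Y\in\mathscr H\}$. Notation: $x^+=\max(x,0)$, $x^-=\max(-x,0)$. In the maxima, $k$ ranges over $0,1,\dots,k_n$. Conditional expectations: write $X\le Y$ in $L_p$ if $\hat{\mathbb E}[((X-Y)^+)^p]=0$, and $X=Y$ in $L_p$ if both $X\le Y$ and $Y\le X$ in $L_p$. Each $\mathscr H_{n,k}$ contains the constants and satisfies: $X_1,\dots,X_d\in\mathscr H_{n,k}$ implies $\varphi(X_1,\dots,X_d)\in\mathscr H_{n,k}$ for all $\varphi\in C_{l,Lip}(\mathbb R^d)$. Put $\mathscr L(\mathscr H)=\{X\in\mathscr H:\hat{\mathbb E}[|X|]<\infty\}$ and similarly $\mathscr L(\mathscr H_{n,k})$. The operators are maps $\hat{\mathbb E}_{n,k}:\mathscr L(\mathscr H)\to\mathscr L(\mathscr H_{n,k})$; one writes $\hat{\mathbb E}[X|\mathscr H_{n,k}]=\hat{\mathbb E}_{n,k}[X]$, $\hat{\mathcal E}[X|\mathscr H_{n,k}]=-\hat{\mathbb E}_{n,k}[-X]$. Properties, for all $X,Y\in\mathscr L(\mathscr H)$: (a) $\hat{\mathbb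 E}_{n,k}[X+Y]=X+\hat{\mathbb E}_{n,k}[Y]$ in $L_1$ if $X\in\mathscr H_{n,k}$; and $\hat{\mathbb E}_{n,k}[XY]=X^+\hat{\mathbb E}_{n,k}[Y]+X^-\hat{\mathbb E}_{n,k}[-Y]$ in $L_1$ if $X\in\mathscr H_{n,k}$ and $XY\in\mathscr L(\mathscr H)$; (b) $\hat{\mathbb E}[\hat{\mathbb E}_{n,k}[X]]=\hat{\mathbb E}[X]$. *)

(* Defs.v *)
From HB Require Import structures.
From mathcomp Require Import all_boot all_order all_algebra.
From mathcomp Require Import all_classical all_reals all_analysis.

Set Implicit Arguments.
Unset Strict Implicit.
Unset Printing Implicit Defensive.

Import Order.TTheory GRing.Theory Num.Theory.

Local Open Scope classical_set_scope.
Local Open Scope ring_scope.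

Definition euclidean_norm (R : realType) (n : nat) (x : 'rV[R]_n) : R :=
  Num.sqrt (\sum_(i < n) x 0 i ^+ 2).

Definition C_lLip (R : realType) (n : nat) (phi : 'rV[R]_n -> R) : Prop :=
  exists (C : R) (m : nat), 0 < C /\
    forall x y : 'rV[R]_n,
      `|phi x - phi y| <=
        C * (1 + euclidean_norm x ^+ m + euclidean_norm y ^+ m)
          * euclidean_norm (x - y).

Definition C_lLip_closed (R : realType) (Omega : Type)
    (H : set (Omega -> R)) : Prop :=
  forall (n : nat) (phi : 'rV[R]_n -> R) (X : 'I_n -> Omega -> R),
    C_lLip phi -> (forall i, H (X i)) -> H (fun w => phi (\row_i X i w)).

Definition linear_space (R : realType) (Omega : Type)
    (H : set (Omega -> R)) : Prop :=
  H (fun=> 0) /\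
  forall (a : R) (X Y : Omega -> R), H X -> H Y -> H (fun w => a * X w + Y w).

(* The expectation is a total function on [Omega -> R]: its axioms concern
   [H] only, and [sle_outside] fixes its values off [H]. *)
Record sublinear_expectation_space (R : realType) d (Omega : measurableType d)
    (H : set (Omega -> R)) (E : (Omega -> R) -> \bar R) : Prop := {
  sle_linear : linear_space H;
  sle_closed : C_lLip_closed H;
  sle_mono : forall X Y, H X -> H Y ->
    (forall w, Y w <= X w) -> (E Y <= E X)%E;
  sle_cst : forall c : R, E (fun=> c) = c%:E;
  (* [x +? y] excludes exactly the two forms +oo - oo and -oo + oo *)
  sle_subadd : forall X Y, H X -> H Y ->
    (E X +? E Y)%E -> (E (fun w => (X w + Y w)%R) <= E X + E Y)%E;
  sle_homog : forall (l : R) X, H X -> 0 <= l ->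
    E (fun w => l * X w) = (l%:E * E X)%E;
  sle_outside : forall X, ~ H X ->
    E X = ereal_inf [set E Y | Y in [set Y | H Y /\ forall w, X w <= Y w]]
}.

(* [powR] takes the value 1 at every negative base, so powers whose base is
   nonnegative only up to an L_1-null variable are taken of the positive part. *)
Definition pos_power (R : realType) (x p : R) : R := (Num.max x 0) `^ p.

Definition le_Lp (R : realType) (Omega : Type) (E : (Omega -> R) -> \bar R)
    (p : R) (X Y : Omega -> R) : Prop :=
  E (fun w => pos_power (X w - Y w) p) = 0%E.

Definition eq_Lp (R : realType) (Omega : Type) (E : (Omega -> R) -> \bar R)
    (p : R) (X Y : Omega -> R) : Prop :=
  le_Lp E p X Y /\ le_Lp E p Y X.

Definition integrable_rv (R : realType) (Omega : Type)
    (H : set (Omega -> R)) (E : (Omega -> R) -> \bar R) : set (Omega -> R) :=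
  [set X | H X /\ (E (fun w => `|X w|%R) < +oo)%E].

Record rv_subspace (R : realType) (Omega : Type)
    (H G : set (Omega -> R)) : Prop := {
  rvs_sub : G `<=` H;
  rvs_linear : linear_space G;
  rvs_cst : forall c : R, G (fun=> c);
  rvs_closed : C_lLip_closed G
}.

Record conditional_expectation (R : realType) (Omega : Type)
    (H : set (Omega -> R)) (E : (Omega -> R) -> \bar R)
    (G : set (Omega -> R)) (EG : (Omega -> R) -> Omega -> R) : Prop := {
  ce_maps : forall X, integrable_rv H E X -> integrable_rv G E (EG X);
  ce_add : forall X Y, integrable_rv H E X -> integrable_rv H E Y -> G X ->
    eq_Lp E 1 (EG (fun w => X w + Y w)) (fun w => X w + EG Y w);
  ce_mul : forall X Y, integrable_rv H E X -> integrable_rv H E Y -> G X ->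
    integrable_rv H E (fun w => X w * Y w) ->
    eq_Lp E 1 (EG (fun w => X w * Y w))
      (fun w => X^\+ w * EG Y w + X^\- w * EG (fun v => - Y v) w);
  ce_tower : forall X, integrable_rv H E X -> E (EG X) = E X
}.

Definition lower_cond (R : realType) (Omega : Type)
    (EG : (Omega -> R) -> Omega -> R) (X : Omega -> R) : Omega -> R :=
  fun w => - EG (fun v => - X v) w.

Definition partial_sum (R : realType) (Omega : Type)
    (Z : nat -> Omega -> R) (k : nat) (w : Omega) : R :=
  \sum_(1 <= i < k.+1) Z i w.

Definition cond_moment_sum (R : realType) (Omega : Type) (N : nat)
    (Ec : nat -> (Omega -> R) -> Omega -> R) (Z : nat -> Omega -> R)
    (f : R -> R) (w : Omega) : R :=
  \sum_(1 <= k < N.+1) Ec k.-1 (fun v => f (Z k v)) w.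

Definition cond_drift_sum (R : realType) (Omega : Type) (N : nat)
    (Ec : nat -> (Omega -> R) -> Omega -> R) (Z : nat -> Omega -> R)
    (w : Omega) : R :=
  \sum_(1 <= k < N.+1)
    ((Ec k.-1 (Z k))^\+ w + (lower_cond (Ec k.-1) (Z k))^\- w).

(* Main.v *)
(* The expectation, extended to all functions by [sle_outside], is monotone and
   sublinear. Properties (a) and (b) say that X - E[X|G], multiplied by a
   bounded nonnegative G-variable, has expectation <= 0, so adding it to any
   integrable variable does not increase the expectation. It is therefore
   enough to prove each inequality pointwise, up to such increments.

   Pointwise, R_k = max_{j<=k} (S_k - S_j) is the walk reflected at 0, that is
   R_k = (R_{k-1} + Z_k)^+, so R_N^2 <= sum (2 R_{k-1} Z_k + Z_k^2), which gives
   the first inequality. With R' the reflected walk of -Z and S* = max |S_k|,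
   one has S* <= 2 max (R_N, R'_N) and R_k, R'_k <= 2 S*, whence
   S*^2 <= 16 S* A + 8 V, with A the drift sum and V the conditional variance
   sum, and the S* on the right is absorbed. The third inequality uses
   (x + z)_+^p <= x^p + p x^{p-1} z + K (x^{p-2} z^2 + |z|^p) instead; there
   x^{p-2} is not Lipschitz at 0 when 2 < p < 3, so it is first replaced by
   max (x, e)^{p-2}, and e tends to 0 at the end. *)

Require Import Defs.
From mathcomp Require Import all_boot all_order all_algebra.
From mathcomp Require Import all_classical all_reals all_analysis.
From mathcomp Require Import ring lra.

Import Order.TTheory GRing.Theory Num.Theory.

Local Open Scope classical_set_scope.
Local Open Scope ring_scope.

(** * Power inequalities *)

Section RealPowers.
Context {R : realType}.
Implicit Types x y u v z p q s a e : R.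

Lemma powR_le x y q : 0 <= q -> 0 <= x -> x <= y -> x `^ q <= y `^ q.
Proof.
move=> q0 x0 xy; apply: ge0_ler_powR => //; rewrite nnegrE //.
exact: le_trans xy.
Qed.

Lemma powRS x q : 0 <= x -> 0 <= q -> x `^ (q + 1) = x * x `^ q.
Proof.
by move=> x0 q0; rewrite -[in RHS](addrK 1 q) mulr_powRB1 // ltr_wpDl.
Qed.

Lemma powR_sub2 x p : 0 <= x -> 2 <= p -> x `^ p = x ^+ 2 * x `^ (p - 2).
Proof.
move=> x0 p2; have q0 : 0 <= p - 2 by rewrite subr_ge0.
have -> : x `^ p = x `^ (p - 2 + 1 + 1) by congr (_ `^ _); ring.
have q1 : 0 <= p - 2 + 1 by rewrite addr_ge0.
by rewrite !powRS // mulrA -expr2.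
Qed.

(* Young's inequality applied to [v * u `^ q]. *)
Lemma powR_tangent u v q : 0 <= q -> 0 <= u -> 0 <= v ->
  u `^ (q + 1) - v `^ (q + 1) <= (q + 1) * u `^ q * (u - v).
Proof.
move=> q0 u0 v0.
(* The conjugate exponents are [q + 1] and [(q + 1) / q], so [q = 0] is treated apart; there both
   sides equal [u - v]. *)
have [->|qN0] := eqVneq q 0.
  by rewrite add0r !powRr1 // powRr0 !mul1r.
have qp : 0 < q by rewrite lt_neqAle eq_sym qN0.
have q1 : 0 < q + 1 by rewrite addr_gt0.
have conj : (q + 1)^-1 + ((q + 1) / q)^-1 = 1.
  by rewrite invf_div -[X in X + _]div1r -mulrDl addrC divff // gt_eqF.
have := conjugate_powR v0 (powR_ge0 u q) q1 (divr_gt0 q1 qp) conj.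
rewrite -powRrM mulrCA divff // mulr1 => h.
have h2 : (q + 1) * (v * u `^ q) <= v `^ (q + 1) + q * u `^ (q + 1).
  rewrite (_ : v `^ (q + 1) + _ =
    (q + 1) * (v `^ (q + 1) / (q + 1) + u `^ (q + 1) / ((q + 1) / q))).
    by rewrite ler_pM2l.
  by field; rewrite ?qN0 gt_eqF.
have e1 : u `^ (q + 1) = u * u `^ q by rewrite powRS.
rewrite mulrBr; move: h2; rewrite e1; nra.
Qed.

(** The tangent inequality at the larger point bounds the difference; its slope is at most the one
    at [c]. *)
Lemma powR_lip x y c q : 0 <= q -> 0 <= x <= c -> 0 <= y <= c ->
  `|x `^ (q + 1) - y `^ (q + 1)| <= (q + 1) * c `^ q * `|x - y|.
Proof.
move=> q0.
wlog xy : x y / y <= x.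
  move=> h hx hy; have [yx|/ltW xy] := leP y x; first exact: h.
  by rewrite distrC [`|x - y|]distrC; exact: h.
move=> /andP[x0 xc] /andP[y0 _].
rewrite !ger0_norm ?subr_ge0 ?powR_le ?addr_ge0 //.
apply: le_trans (powR_tangent _ _ _ q0 x0 y0) _.
by rewrite ler_wpM2r ?subr_ge0 // ler_wpM2l ?addr_ge0 // powR_le.
Qed.

(* The inverse-distance factor [e^-1] allows small exponents [q], for which
   [x `^ q] is not Lipschitz at 0. *)
Lemma powR_max_lip x y c e q : 0 <= q -> 0 < e -> x <= c -> y <= c -> e <= c ->
  `|Num.max x e `^ q - Num.max y e `^ q|
    <= (q + 1) * c `^ q / e * `|x - y|.
Proof.
move=> q0 e0.
wlog xy : x y / y <= x.
  move=> h hx hy; have [yx|/ltW xy] := leP y x; first exact: h.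
  by rewrite distrC [`|x - y|]distrC; exact: h.
move=> xc yc ec.
set u := Num.max x e; set v := Num.max y e.
have vu : v <= u by rewrite /u /v ge_max !le_max xy lexx !orbT.
have ev : e <= v by rewrite /v le_max lexx orbT.
have v0 : 0 < v by exact: lt_le_trans ev.
have u0 : 0 < u by exact: lt_le_trans vu.
have uc : u <= c by rewrite /u ge_max xc ec.
have uv : u - v <= x - y.
  by rewrite /u /v; case: (leP x e); case: (leP y e); lra.
have c0 := powR_ge0 c q.
have pvu : v `^ q <= u `^ q by rewrite powR_le // ltW.
rewrite ger0_norm ?subr_ge0 // [`|x - y|]ger0_norm ?subr_ge0 //.
rewrite [_ / e * _]mulrAC ler_pdivlMr //.
have h := powR_tangent u v q q0 (ltW u0) (ltW v0).
(* Since e <= v <= u, multiplying by [e] raises the exponent by one, where the tangent inequality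
   [h] applies. *)
have h2 : (u `^ q - v `^ q) * e <= u `^ (q + 1) - v `^ (q + 1).
  rewrite !powRS ?(ltW u0) ?(ltW v0) //.
  apply: (@le_trans _ _ ((u `^ q - v `^ q) * v)).
    by rewrite ler_wpM2l ?subr_ge0.
  have := powR_ge0 u q; nra.
apply: le_trans h2 _; apply: le_trans h _.
have puc : u `^ q <= c `^ q by rewrite powR_le // ltW.
rewrite ler_pM ?subr_ge0 ?mulr_ge0 ?addr_ge0 ?powR_ge0 //.
by rewrite ler_wpM2l ?addr_ge0.
Qed.

(* Locked so that positivity lemmas such as [mulr_ge0] do not unfold it. *)
Definition taylor_const p : R := locked (p * (p - 1) * 2 `^ (p - 2)).

Lemma taylor_const_ge p : 2 <= p -> p <= taylor_const p.
Proof.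
move=> p2; rewrite /taylor_const -lock.
have h : 1 <= 2 `^ (p - 2) :> R.
  by have := powR_le 1 2 (p - 2); rewrite powR1; apply; lra.
have : p <= p * (p - 1) by nra.
move=> h2; apply: le_trans h2 _; rewrite ler_peMr //; nra.
Qed.

(** The tangent inequality at [x + z] has slope p (x + z)^(p-1). Moving the slope back to x costs p
    times the variation of t^(p-1) times z, which [powR_lip] on [0, x + |z|] makes second order in
    z. *)
Lemma powR_add_le x z p : 2 <= p -> 0 <= x -> 0 <= x + z ->
  (x + z) `^ p <= x `^ p + p * x `^ (p - 1) * z
     + taylor_const p * (x `^ (p - 2) * z ^+ 2 + `|z| `^ p).
Proof.
move=> p2 x0 xz0.
have e1 : p = (p - 1) + 1 by ring.
have e2 : p - 1 = (p - 2) + 1 by ring.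
have p1 : 0 <= p - 1 by lra.
have pp2 : 0 <= p - 2 by lra.
have h1 : (x + z) `^ p - x `^ p <= p * (x + z) `^ (p - 1) * z.
  have := powR_tangent (x + z) x (p - 1) p1 xz0 x0.
  by rewrite -e1 addrAC subrr add0r.
have nz := normr_ge0 z.
pose c := x + `|z|.
have c0 : 0 <= c by rewrite addr_ge0.
have h2 : `|(x + z) `^ (p - 1) - x `^ (p - 1)| <= (p - 1) * c `^ (p - 2) * `|z|.
  have := powR_lip (x + z) x c (p - 2) pp2.
  rewrite -e2 addrAC subrr add0r; apply.
    by rewrite xz0 /c lerD2l ler_norm.
  by rewrite x0 lerDl.
(* A sum is at most twice the maximum; this suits every exponent p - 2 >= 0, whether or not t^(p-2)
   is convex. *)
have h3 : c `^ (p - 2) <= 2 `^ (p - 2) * (x `^ (p - 2) + `|z| `^ (p - 2)).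
  apply: (@le_trans _ _ ((2 * Num.max x `|z|) `^ (p - 2))).
    by apply: powR_le => //; rewrite /c; case: (leP x `|z|); lra.
  rewrite powRM ?le_max ?x0 // ler_wpM2l ?powR_ge0 //.
  have := powR_ge0 x (p - 2); have := powR_ge0 `|z| (p - 2).
  by case: (leP x `|z|); lra.
have h4 : `|z| `^ p = z ^+ 2 * `|z| `^ (p - 2).
  by rewrite powR_sub2 // real_normK ?num_real.
have h5 : ((x + z) `^ (p - 1) - x `^ (p - 1)) * z <=
   (p - 1) * c `^ (p - 2) * z ^+ 2.
  apply: le_trans (ler_norm _) _; rewrite normrM.
  apply: le_trans (ler_wpM2r nz h2) _.
  by rewrite -(@real_normK _ z) ?num_real // expr2 mulrA.
have h6 : (p - 1) * c `^ (p - 2) * z ^+ 2 <=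
  (p - 1) * (2 `^ (p - 2) * (x `^ (p - 2) + `|z| `^ (p - 2))) * z ^+ 2.
  by rewrite ler_wpM2r ?sqr_ge0 // ler_wpM2l.
have h7 : p * (((x + z) `^ (p - 1) - x `^ (p - 1)) * z) <=
   p * ((p - 1) * (2 `^ (p - 2) * (x `^ (p - 2) + `|z| `^ (p - 2))) * z ^+ 2).
  by rewrite ler_wpM2l ?(le_trans h5) //; lra.
move: h1 h7; rewrite h4 /taylor_const -lock; lra.
Qed.

(** If x + z < 0 the left side is 0, and on the right only the linear term is negative. As x < -z,
    it is absorbed by p x^(p-2) z^2, and p <= [taylor_const p]. *)
Lemma powR_reflect_le x z p : 2 <= p -> 0 <= x ->
  Num.max (x + z) 0 `^ p <= x `^ p + p * x `^ (p - 1) * z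
     + taylor_const p * (x `^ (p - 2) * z ^+ 2 + `|z| `^ p).
Proof.
move=> p2 x0; case: (leP 0 (x + z)) => [h|h]; first exact: powR_add_le.
have e1 : p = (p - 1) + 1 by ring.
have e2 : p - 1 = (p - 2) + 1 by ring.
have -> : 0 `^ p = 0 :> R by rewrite powR0 // gt_eqF //; lra.
have K := taylor_const_ge p p2.
have a1 : x `^ (p - 1) = x * x `^ (p - 2).
  by rewrite {1}e2 powRS //; lra.
have := powR_ge0 x p; have := powR_ge0 x (p - 2); have := powR_ge0 `|z| p.
rewrite a1; set X := x `^ (p - 2); set Y := _ `^ p; set W := _ `^ p.
move=> Y0 X0 W0.
have b1 : 0 <= (taylor_const p - p) * (X * z ^+ 2).
  by rewrite mulr_ge0 ?subr_ge0 // mulr_ge0 // sqr_ge0.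
have b2 : 0 <= p * X * ((- z) * (- z - x)).
  by rewrite !mulr_ge0 //; lra.
have b3 : 0 <= taylor_const p * Y by rewrite mulr_ge0 //; lra.
lra.
Qed.

(** Young's inequality without optimal constants, by cases: if a <= dl s, replace a by dl s;
    otherwise replace s by a / dl. *)
Lemma young_eps_l s a dl p : 1 <= p -> 0 < dl -> 0 <= s -> 0 <= a ->
  s `^ (p - 1) * a <= dl * s `^ p + dl^-1 `^ (p - 1) * a `^ p.
Proof.
move=> p1 d0 s0 a0.
have p10 : 0 <= p - 1 by lra.
have hp t : 0 <= t -> t `^ p = t * t `^ (p - 1).
  by move=> t0; rewrite -powRS // subrK.
have d0' := ltW d0.
have di : 0 <= dl^-1 by rewrite invr_ge0.
have [h|/ltW h] := leP a (dl * s).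
  rewrite -[leLHS]addr0 lerD ?mulr_ge0 ?powR_ge0 //.
  by rewrite hp // mulrA mulrC ler_wpM2r ?powR_ge0.
rewrite -[leLHS]add0r lerD ?mulr_ge0 ?powR_ge0 //.
rewrite hp // mulrCA mulrC. rewrite ler_wpM2l // -powRM //.
by apply: powR_le => //; rewrite mulrC ler_pdivlMr // mulrC.
Qed.

(** The same dichotomy, comparing v with dl s^2, after writing s^(p-2) as the power (p-2)/2 of
    s^2. *)
Lemma young_eps_q s v dl p : 2 <= p -> 0 < dl -> 0 <= s -> 0 <= v ->
  s `^ (p - 2) * v <= dl * s `^ p + dl^-1 `^ ((p - 2) / 2) * v `^ (p / 2).
Proof.
move=> p2 d0 s0 v0.
have p20 : 0 <= (p - 2) / 2 by rewrite divr_ge0 // subr_ge0.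
have p10 : 0 <= p - 2 by lra.
have d0' := ltW d0.
have di : 0 <= dl^-1 by rewrite invr_ge0.
have hs := powR_sub2 s p s0 p2.
have hv : v `^ (p / 2) = v * v `^ ((p - 2) / 2).
  by rewrite -powRS //; congr (_ `^ _); field.
have hq : s `^ (p - 2) = (s ^+ 2) `^ ((p - 2) / 2).
  by rewrite -powR_mulrn // -powRrM mulrCA divff ?mulr1.
have [h|/ltW h] := leP v (dl * s ^+ 2).
  rewrite -[leLHS]addr0 lerD ?mulr_ge0 ?powR_ge0 //.
  by rewrite hs mulrA mulrC ler_wpM2r ?powR_ge0.
rewrite -[leLHS]add0r lerD ?mulr_ge0 ?powR_ge0 //.
rewrite hv mulrCA mulrC ler_wpM2l // -powRM // hq.
by apply: powR_le; rewrite // ?sqr_ge0 // mulrC ler_pdivlMr // mulrC.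
Qed.

(** One summand of the p-th power bound. Read [a], [v], [w] as the conditional expectations of z,
    z^2 and y = |z|^p: the right side splits off the compensated terms. As [v] may be negative,
    raising its weight to s^(p-2) costs at most c^(p-2) times its negative part. *)
Lemma powR_compensated_step p r z a v y w s c e : 2 <= p -> 0 <= r -> r <= s ->
  0 < e -> e <= s -> s <= c ->
  p * r `^ (p - 1) * z + taylor_const p * (r `^ (p - 2) * z ^+ 2 + y) <=
    p * (r `^ (p - 1) * (z - a))
    + taylor_const p * (Num.max r e `^ (p - 2) * (z ^+ 2 - v)
        + ((y - w) + c `^ (p - 2) * Num.max (- v) 0))
    + (p * (s `^ (p - 1) * Num.max a 0)
       + taylor_const p * (s `^ (p - 2) * v + w)).
Proof.
move=> p2 r0 rs e0 es sc.
have K0 : 0 <= taylor_const p by have := taylor_const_ge p p2; lra.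
have s0 : 0 <= s := le_trans r0 rs.
have hm : r <= Num.max r e by rewrite le_max lexx.
have x0 : r `^ (p - 2) <= Num.max r e `^ (p - 2) by rewrite powR_le // subr_ge0.
have x1 : Num.max r e `^ (p - 2) <= s `^ (p - 2).
  by rewrite powR_le ?subr_ge0 // ?ge_max ?rs // (le_trans r0).
have x2 : s `^ (p - 2) <= c `^ (p - 2) by rewrite powR_le ?subr_ge0.
have x3 : r `^ (p - 1) <= s `^ (p - 1) by rewrite powR_le //; lra.
have x4 := powR_ge0 r (p - 1); have x5 := powR_ge0 (Num.max r e) (p - 2).
set R1 := r `^ (p - 1) in x3 x4 *; set S1 := s `^ (p - 1) in x3 *.
set X := Num.max r e `^ (p - 2) in x0 x1 x5 *.
set S2 := s `^ (p - 2) in x1 x2 *; set C2 := c `^ (p - 2) in x2 *.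
set R2 := r `^ (p - 2) in x0 *.
have h1 : R1 * a <= S1 * Num.max a 0 by case: (leP a 0) => ?; nra.
have h2 : X * v <= S2 * v + C2 * Num.max (- v) 0.
  by case: (leP (- v) 0) => ?; nra.
have h3 : R2 * z ^+ 2 <= X * z ^+ 2 by rewrite ler_wpM2r ?sqr_ge0.
have h4 : p * (R1 * a) <= p * (S1 * Num.max a 0) by rewrite ler_wpM2l //; lra.
have h5 : taylor_const p * (R2 * z ^+ 2 + X * v) <=
  taylor_const p * (X * z ^+ 2 + (S2 * v + C2 * Num.max (- v) 0)).
  by rewrite ler_wpM2l // lerD.
lra.
Qed.

End RealPowers.

(** * Reflected walks *)

Section ReflectedWalk.
Context {R : realType}.
Implicit Types (z : nat -> R) (N k j : nat).

Definition walk z k : R := \sum_(1 <= i < k.+1) z i.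

(** Lindley's recursion. By [reflected_ge] and [reflected_attained] its value at k is the maximum
    over j <= k of S_k - S_j. *)
Fixpoint reflected z k : R :=
  if k is j.+1 then Num.max (reflected z j + z j.+1) 0 else 0.

Definition max_abs z N : R := \big[Num.max/0]_(0 <= k < N.+1) `|walk z k|.

Lemma walk0 z : walk z 0 = 0. Proof. by rewrite /walk big_geq. Qed.

Lemma walkS z k : walk z k.+1 = walk z k + z k.+1.
Proof. by rewrite /walk big_nat_recr. Qed.

Lemma walkN z k : walk (fun i => - z i) k = - walk z k.
Proof. by rewrite /walk sumrN. Qed.

Lemma reflected_ge0 z k : 0 <= reflected z k.
Proof. by case: k => //= k; rewrite le_max lexx orbT. Qed.

Lemma reflected_ge z k j : (j <= k)%N -> walk z k - walk z j <= reflected z k.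
Proof.
elim: k => [|k IH]; first by rewrite leqn0 => /eqP ->; rewrite subrr.
rewrite leq_eqVlt => /orP[/eqP->|]; first by rewrite subrr reflected_ge0.
by rewrite ltnS => /IH h; rewrite /= le_max walkS addrAC lerD2r h.
Qed.

Lemma reflected_attained z k :
  exists2 j, (j <= k)%N & reflected z k = walk z k - walk z j.
Proof.
elim: k => [|k [j jk IH]]; first by exists 0%N => //; rewrite subrr.
rewrite /= IH; case: leP => _; last first.
  by exists j; [exact: leqW|rewrite walkS addrAC].
by exists k.+1; rewrite ?subrr.
Qed.

Lemma max_abs_ge0 z N : 0 <= max_abs z N.
Proof. exact: bigmax_ge_id. Qed.

Lemma max_abs_ge z N k : (k <= N)%N -> `|walk z k| <= max_abs z N.
Proof.
move=> kN; apply: (@le_bigmax_seq _ _ _ _ _ k) => //.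
by rewrite mem_index_iota ltnS.
Qed.

Lemma max_abs_lub z N c : 0 <= c ->
  (forall k, (k <= N)%N -> `|walk z k| <= c) -> max_abs z N <= c.
Proof.
move=> c0 h; rewrite /max_abs big_seq; apply: bigmax_le => // k.
by rewrite mem_index_iota ltnS => /h.
Qed.

Lemma max_absN z N : max_abs (fun i => - z i) N = max_abs z N.
Proof. by apply: eq_bigr => k _; rewrite walkN normrN. Qed.

Lemma reflected_le_max_abs z N k : (k <= N)%N ->
  reflected z k <= 2 * max_abs z N.
Proof.
move=> kN; have [j jk ->] := reflected_attained z k.
have := max_abs_ge z N k kN; have := max_abs_ge z N j (leq_trans jk kN).
rewrite !ler_norml => /andP[? ?] /andP[? ?]; lra.
Qed.

(** Each |S_N - S_j| is bounded by one of the two reflected walks, according to its sign; then S_k =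
    (S_N - S_0) - (S_N - S_k) gives the factor 2. *)
Lemma max_abs_le_reflected z N :
  max_abs z N <=
    2 * Num.max (reflected z N) (reflected (fun i => - z i) N).
Proof.
set m := Num.max _ _.
have hm j : (j <= N)%N -> `|walk z N - walk z j| <= m.
  move=> jN; have h1 := reflected_ge z N j jN.
  have := reflected_ge (fun i => - z i) N j jN.
  rewrite !walkN => h2; rewrite /m le_max !ler_norml.
  have [?|/ltW ?] := leP (walk z j) (walk z N); apply/orP; [left|right];
    by apply/andP; split; lra.
have m0 : 0 <= m by rewrite (le_trans _ (hm N _)).
apply: max_abs_lub => [|k kN]; first by rewrite mulr_ge0.
have := hm k kN; have := hm 0%N isT; rewrite walk0 subr0 !ler_norml.
move=> /andP[? ?] /andP[? ?]; apply/andP; split; lra.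
Qed.

Lemma max_abs_bound z N M : 0 <= M ->
  (forall k, (1 <= k <= N)%N -> `|z k| <= M) -> max_abs z N <= N%:R * M.
Proof.
move=> M0 hz; apply: max_abs_lub => [|k kN]; first by rewrite mulr_ge0.
apply: (@le_trans _ _ (k%:R * M)); last by rewrite ler_wpM2r // ler_nat.
elim: k kN => [|k IH] kN; first by rewrite walk0 normr0 mul0r.
rewrite walkS (le_trans (ler_normD _ _)) // -natr1 mulrDl mul1r lerD //.
  by apply: IH; exact: ltnW.
by apply: hz; rewrite kN.
Qed.

Lemma reflected_telescope (f : R -> R) (g : nat -> R) z N : f 0 = 0 ->
  (forall k, f (reflected z k.+1) <= f (reflected z k) + g k.+1) ->
  f (reflected z N) <= \sum_(1 <= k < N.+1) g k.
Proof.
move=> f0 h; elim: N => [|N IH]; first by rewrite /= f0 big_geq.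
by rewrite big_nat_recr //= (le_trans (h N)) // lerD2r.
Qed.

Lemma reflected_sq_le z N : reflected z N ^+ 2 <=
  \sum_(1 <= k < N.+1) (2 * reflected z k.-1 * z k + z k ^+ 2).
Proof.
apply: (@reflected_telescope (fun x => x ^+ 2)) => [|k /=].
  by rewrite expr0n.
have := sqr_ge0 (reflected z k + z k.+1).
by case: (leP (reflected z k + z k.+1) 0) => _; rewrite ?expr0n /=; lra.
Qed.

Lemma reflected_powR_le z N p : 2 <= p -> reflected z N `^ p <=
  \sum_(1 <= k < N.+1) (p * reflected z k.-1 `^ (p - 1) * z k
    + taylor_const p * (reflected z k.-1 `^ (p - 2) * z k ^+ 2 + `|z k| `^ p)).
Proof.
move=> p2; apply: (@reflected_telescope (fun x => x `^ p)) => [|k /=].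
  by rewrite powR0 // gt_eqF //; lra.
by rewrite addrA; apply: powR_reflect_le => //; exact: reflected_ge0.
Qed.

End ReflectedWalk.

(** * Sublinear expectations *)

Section SublinearExpectation.
Context {R : realType} {d : measure_display} {Omega : measurableType d}.
Context {H : set (Omega -> R)} {E : (Omega -> R) -> \bar R}.
Hypothesis HE : sublinear_expectation_space H E.
Implicit Types (X Y U : Omega -> R).

(** On [H], monotonicity makes [X] itself the best majorant. The formula for functions outside [H]
    thus holds everywhere, and [E] can be compared without tracking membership. *)
Lemma sle_infE X :
  E X = ereal_inf [set E Y | Y in [set Y | H Y /\ forall w, X w <= Y w]].
Proof.
have [HX|HX] := pselect (H X); last exact: sle_outside HE X HX.
apply/eqP; rewrite eq_le; apply/andP; split.
  by apply: le_ereal_inf_tmp => _ [Y [HY XY] <-]; exact: sle_mono HE Y X HY HX XY.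
by apply: ereal_inf_lbound; exists X.
Qed.

Lemma sle_le X Y : (forall w, X w <= Y w) -> (E X <= E Y)%E.
Proof.
move=> XY; rewrite (sle_infE X) (sle_infE Y).
apply: ereal_inf_le_tmp => _ [V [HV YV] <-]; exists V => //; split=> // w.
exact: le_trans (XY w) (YV w).
Qed.

Lemma sle_ge0 X : (forall w, 0 <= X w) -> (0 <= E X)%E.
Proof. by move=> X0; rewrite -[leLHS](sle_cst HE); exact: sle_le. Qed.

Lemma sle_lt_majorant X (a : \bar R) : (E X < a)%E ->
  exists Y, [/\ H Y, forall w, X w <= Y w & (E Y < a)%E].
Proof.
by rewrite sle_infE => /ereal_inf_lt[_ [Y [HY XY] <-] Ya]; exists Y.
Qed.

(** Strict finite bounds provide majorants in [H], where subadditivity is an axiom, and exclude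
    undefined sums of infinities. *)
Lemma sle_add_lt X Y (a b : R) : (E X < a%:E)%E -> (E Y < b%:E)%E ->
  (E (fun w => X w + Y w)%R <= (a + b)%:E)%E.
Proof.
move=> /sle_lt_majorant[X' [HX XX' aX]] /sle_lt_majorant[Y' [HY YY' bY]].
apply: (@le_trans _ _ (E (fun w => X' w + Y' w)%R)).
  by apply: sle_le => w; rewrite lerD.
apply: (@le_trans _ _ (E X' + E Y')%E); last by rewrite EFinD leeD // ltW.
apply: sle_subadd HE _ _ HX HY _.
by rewrite ltpinfty_adde_def // inE; [exact: lt_trans aX (ltry a)|
  exact: lt_trans bY (ltry b)].
Qed.

Lemma sle_scale_lt X (l a : R) : 0 <= l -> (E X < a%:E)%E ->
  (E (fun w => l * X w)%R <= (l * a)%:E)%E.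
Proof.
move=> l0 /sle_lt_majorant[Y [HY XY aY]].
apply: (@le_trans _ _ (E (fun w => l * Y w)%R)).
  by apply: sle_le => w; rewrite ler_wpM2l.
by rewrite (sle_homog HE HY l0) EFinM lee_wpmul2l ?lee_fin // ltW.
Qed.

Definition sl_integrable X : Prop := (E (fun w => `|X w|)%R < +oo)%E.

Definition ev X : R := fine (E X).

(** Serves to dismiss the cases in which the right side of a maximal inequality is infinite. *)
Lemma sl_integrable_or_pinfty X : (forall w, 0 <= X w) ->
  sl_integrable X \/ E X = +oo%E.
Proof.
move=> X0; rewrite /sl_integrable; under [X in E X]eq_fun do rewrite ger0_norm //.
have [->|] := eqVneq (E X) +oo%E; [by right|by rewrite -ltey; left].
Qed.

Lemma sl_integrable_dom X Y : (forall w, `|X w| <= Y w) -> (E Y < +oo)%E ->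
  sl_integrable X.
Proof. by move=> XY; apply: le_lt_trans; exact: sle_le. Qed.

Lemma sl_integrable_le X Y : (forall w, `|X w| <= `|Y w|) -> sl_integrable Y ->
  sl_integrable X.
Proof. exact: sl_integrable_dom. Qed.

Lemma sl_integrable_bounded X c : (forall w, `|X w| <= c) -> sl_integrable X.
Proof.
by move=> Xc; apply: (@sl_integrable_dom _ (fun=> c)); rewrite ?(sle_cst HE) ?ltry.
Qed.

Lemma sl_integrable_lt X : sl_integrable X ->
  exists a : R, (E (fun w => `|X w|)%R < a%:E)%E.
Proof.
rewrite /sl_integrable; case: (E _) => [r _|//|_]; last by exists 0; exact: ltNyr.
by exists (r + 1); rewrite lte_fin ltrDl.
Qed.

Lemma sl_integrableD X Y : sl_integrable X -> sl_integrable Y ->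
  sl_integrable (fun w => X w + Y w).
Proof.
move=> /sl_integrable_lt[a Xa] /sl_integrable_lt[b Yb].
apply: (@sl_integrable_dom _ (fun w => `|X w| + `|Y w|)) => [w|].
  exact: ler_normD.
exact: le_lt_trans (sle_add_lt _ _ _ _ Xa Yb) (ltry _).
Qed.

Lemma sl_integrableZ (l : R) X : sl_integrable X ->
  sl_integrable (fun w => l * X w).
Proof.
move=> /sl_integrable_lt[a Xa].
apply: (@sl_integrable_dom _ (fun w => `|l| * `|X w|)) => [w|].
  by rewrite normrM.
exact: le_lt_trans (sle_scale_lt _ _ _ (normr_ge0 l) Xa) (ltry _).
Qed.

Lemma sl_integrableN X : sl_integrable X -> sl_integrable (fun w => - X w).
Proof. by apply: sl_integrable_le => w; rewrite normrN. Qed.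

Lemma sl_integrableB X Y : sl_integrable X -> sl_integrable Y ->
  sl_integrable (fun w => X w - Y w).
Proof. by move=> iX iY; apply: sl_integrableD => //; exact: sl_integrableN. Qed.

Lemma sl_integrable_mulb X Y c : (forall w, `|X w| <= c) -> sl_integrable Y ->
  sl_integrable (fun w => X w * Y w).
Proof.
move=> Xc iY; apply: (@sl_integrable_le _ (fun w => c * Y w));
  last exact: sl_integrableZ.
move=> w; rewrite !normrM ler_wpM2r //; exact: le_trans (Xc w) (ler_norm _).
Qed.

Lemma sl_integrable_sum (I : eqType) (r : seq I) (F : I -> Omega -> R) :
  (forall i, i \in r -> sl_integrable (F i)) ->
  sl_integrable (fun w => \sum_(i <- r) F i w).
Proof.
elim: r => [_|i r IH h].
  by apply: (@sl_integrable_bounded _ 0) => w; rewrite big_nil normr0.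
under [X in sl_integrable X]eq_fun do rewrite big_cons.
apply: sl_integrableD; first by apply: h; rewrite inE eqxx.
by apply: IH => j jr; apply: h; rewrite inE jr orbT.
Qed.

(** The value -oo has to be excluded. For a majorant [Y] of |X| in [H], 0 = E[Y - Y] <= E[Y] + E[-Y]
    keeps E[-Y] above -oo, and -Y <= X. *)
Lemma sl_integrable_fin_num X : sl_integrable X -> E X \is a fin_num.
Proof.
move=> iX; have [Y [HY XY EY]] := sle_lt_majorant _ _ iX.
have EN0 : (E (fun w => - Y w)%R <= 0)%E.
  rewrite -[leRHS](sle_cst HE); apply: sle_le => w.
  by rewrite oppr_le0 (le_trans _ (XY w)).
have HN : H (fun w => - Y w).
  have [H0 Hlin] := sle_linear HE.
  by under eq_fun do rewrite -[- _]addr0 -mulN1r; exact: (Hlin (-1)).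
have h : (0 <= E Y + E (fun w => - Y w)%R)%E.
  rewrite -[leLHS](sle_cst HE).
  have -> : (fun=> 0) = (fun w => Y w + - Y w).
    by apply/funext => w; rewrite subrr.
  apply: sle_subadd HE _ _ HY HN _; rewrite ltpinfty_adde_def // inE.
  exact: le_lt_trans EN0 (ltry _).
have EX : (E (fun w => - Y w)%R <= E X)%E.
  apply: sle_le => w; have := XY w; rewrite lerNl => h'.
  by rewrite (le_trans _ h') // -normrN ler_norm.
rewrite fin_numE; apply/andP; split.
  apply/eqP => EXy; move: EX; rewrite EXy leeNy_eq => /eqP EXN.
  by move: h; rewrite EXN; case: (E Y).
apply/eqP => EXy; have : (E X <= E (fun w => `|X w|)%R)%E.
  by apply: sle_le => w; exact: ler_norm.
by rewrite EXy leye_eq => /eqP h'; move: iX; rewrite /sl_integrable h'.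
Qed.

Lemma evE X : sl_integrable X -> E X = (ev X)%:E.
Proof. by move=> iX; rewrite /ev fineK // sl_integrable_fin_num. Qed.

Lemma ev_cst c : ev (fun=> c) = c.
Proof. by rewrite /ev (sle_cst HE). Qed.

Lemma ev_le X Y : sl_integrable X -> sl_integrable Y -> (forall w, X w <= Y w) ->
  ev X <= ev Y.
Proof. by move=> iX iY /sle_le; rewrite !evE // lee_fin. Qed.

Lemma ev_ge0 X : sl_integrable X -> (forall w, 0 <= X w) -> 0 <= ev X.
Proof.
move=> iX X0; rewrite -(ev_cst 0); apply: ev_le => //.
by apply: (@sl_integrable_bounded _ 0) => w; rewrite normr0.
Qed.

(** [sle_add_lt] asks for strict bounds, so each expectation gets slack e / 2, with e arbitrary. *)
Lemma evD X Y : sl_integrable X -> sl_integrable Y ->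
  ev (fun w => X w + Y w) <= ev X + ev Y.
Proof.
move=> iX iY; apply/ler_addgt0Pr => e e0; have e20 : 0 < e / 2 by rewrite divr_gt0.
have h : (E (fun w => X w + Y w)%R <= ((ev X + e / 2) + (ev Y + e / 2))%:E)%E.
  by apply: sle_add_lt; rewrite evE // lte_fin ltrDl.
move: h; rewrite evE ?lee_fin; last exact: sl_integrableD.
by move=> h; rewrite (le_trans h) // addrACA -splitr.
Qed.

Lemma evZ l X : 0 <= l -> sl_integrable X -> ev (fun w => l * X w) <= l * ev X.
Proof.
move=> l0 iX; apply/ler_addgt0Pr => e e0.
(* Dividing the slack by [l + 1] rather than [l] allows [l = 0]. *)
have l10 : 0 < l + 1 by rewrite ltr_wpDl.
have h : (E (fun w => l * X w)%R <= (l * (ev X + e / (l + 1)))%:E)%E.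
  by apply: sle_scale_lt; rewrite // evE // lte_fin ltrDl divr_gt0.
move: h; rewrite evE ?lee_fin; last exact: sl_integrableZ.
move=> h; rewrite (le_trans h) // mulrDr lerD2l mulrCA ler_piMr ?ltW //.
by rewrite ltr_pdivrMr // mul1r ltrDl.
Qed.

(* By subadditivity, adding such a variable does not increase [ev]. *)
Definition subnull U : Prop := sl_integrable U /\ ev U <= 0.

Lemma subnullD X Y : subnull X -> subnull Y -> subnull (fun w => X w + Y w).
Proof.
move=> [iX X0] [iY Y0]; split; first exact: sl_integrableD.
by rewrite (le_trans (evD _ _ iX iY)) // -[leRHS]addr0 lerD.
Qed.

Lemma subnullZ l X : 0 <= l -> subnull X -> subnull (fun w => l * X w).
Proof.
move=> l0 [iX X0]; split; first exact: sl_integrableZ.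
by rewrite (le_trans (evZ _ _ l0 iX)) // mulr_ge0_le0.
Qed.

Lemma subnull_le X Y : sl_integrable X -> (forall w, X w <= Y w) ->
  subnull Y -> subnull X.
Proof.
move=> iX XY [iY Y0]; split=> //; exact: le_trans (ev_le _ _ iX iY XY) Y0.
Qed.

Lemma subnull0 : subnull (fun=> 0).
Proof.
split; last by rewrite ev_cst.
by apply: (@sl_integrable_bounded _ 0) => w; rewrite normr0.
Qed.

Lemma subnull_sum (I : eqType) (r : seq I) (F : I -> Omega -> R) :
  (forall i, i \in r -> subnull (F i)) ->
  subnull (fun w => \sum_(i <- r) F i w).
Proof.
elim: r => [_|i r IH h].
  by under eq_fun do rewrite big_nil; exact: subnull0.
under eq_fun do rewrite big_cons.
apply: subnullD; first by apply: h; rewrite inE eqxx.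
by apply: IH => j jr; apply: h; rewrite inE jr orbT.
Qed.

(** The passage from pointwise inequalities to expectations: [U] collects the compensated increments
    and disappears. *)
Lemma ev_le_subnull X U Y : sl_integrable X -> subnull U -> sl_integrable Y ->
  (forall w, X w <= U w + Y w) -> ev X <= ev Y.
Proof.
move=> iX [iU U0] iY h; apply: le_trans (ev_le _ _ iX (sl_integrableD _ _ iU iY) h) _.
by rewrite (le_trans (evD _ _ iU iY)) // -[leRHS]add0r lerD2r.
Qed.

End SublinearExpectation.

(** * Closure under Lipschitz maps *)

Lemma dist_max_le {R : realDomainType} (x y c : R) :
  `|Num.max x c - Num.max y c| <= `|x - y|.
Proof.
rewrite ler_norml.
by case: (leP x c) => ?; case: (leP y c) => ?; case: (ger0P (x - y)) => ?; lra.
Qed.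

Lemma norm_max0_le {R : realDomainType} (x : R) : `|Num.max x 0| <= `|x|.
Proof. by have := dist_max_le x 0 0; rewrite maxxx !subr0. Qed.

Lemma dist_min_le {R : realDomainType} (x y c : R) :
  `|Num.min x c - Num.min y c| <= `|x - y|.
Proof.
rewrite ler_norml.
by case: (leP x c) => ?; case: (leP y c) => ?; case: (ger0P (x - y)) => ?; lra.
Qed.

Section LipschitzClosure.
Context {R : realType} {Omega : Type}.
Context {G : set (Omega -> R)}.
Hypotheses (Glin : linear_space G) (Gclosed : C_lLip_closed G).
Implicit Types (X Y : Omega -> R) (phi : R -> R) (C L a b l : R).

(** Growth exponent 1 in [C_lLip] covers both Lipschitz maps and the square. *)
Lemma closed_comp phi C X : 0 < C ->
  (forall x y, `|phi x - phi y| <= C * (1 + `|x| + `|y|) * `|x - y|) ->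
  G X -> G (fun w => phi (X w)).
Proof.
move=> C0 hphi GX.
have nrm (x : 'rV[R]_1) : euclidean_norm x = `|x 0 0|.
  by rewrite /euclidean_norm big_ord1 sqrtr_sqr.
have -> : (fun w => phi (X w)) =
    (fun w => (fun x : 'rV[R]_1 => phi (x 0 0)) (\row_(i < 1) X w)).
  by apply/funext => w; rewrite mxE.
apply: (Gclosed 1%N (fun x => phi (x 0 0)) (fun=> X)) => //.
exists C, 1%N; split=> // x y; rewrite !nrm !expr1 !mxE.
exact: hphi.
Qed.

Lemma closed_lip phi L X : (forall x y, `|phi x - phi y| <= L * `|x - y|) ->
  G X -> G (fun w => phi (X w)).
Proof.
move=> h; apply: (@closed_comp _ (`|L| + 1)) => [|x y]; first by rewrite ltr_wpDl.
apply: le_trans (h x y) _; rewrite ler_wpM2r //.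
have := ler_norm L; have := normr_ge0 L.
have := normr_ge0 x; have := normr_ge0 y; nra.
Qed.

(** Projecting to an interval that contains the range of [X] leaves [X] unchanged and makes the
    composed map globally Lipschitz. Real powers are handled this way. *)
Lemma closed_lip_on phi L a b X : a <= b -> (forall w, a <= X w <= b) ->
  (forall x y, a <= x <= b -> a <= y <= b -> `|phi x - phi y| <= L * `|x - y|) ->
  G X -> G (fun w => phi (X w)).
Proof.
move=> ab Xab h GX; pose clamp x : R := Num.max (Num.min x b) a.
have clampab x : a <= clamp x <= b.
  by rewrite /clamp le_max lexx orbT ge_max ge_min lexx orbT ab.
have clampL x y : `|clamp x - clamp y| <= `|x - y|.
  exact: le_trans (dist_max_le _ _ _) (dist_min_le _ _ _).
have -> : (fun w => phi (X w)) = (fun w => phi (clamp (X w))).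
  apply/funext => w; congr phi; have /andP[aX Xb] := Xab w.
  by rewrite /clamp min_l // max_l.
apply: (@closed_lip (phi \o clamp) `|L|) => // x y /=.
apply: le_trans (h _ _ (clampab x) (clampab y)) _.
apply: le_trans (ler_wpM2r (normr_ge0 _) (ler_norm L)) _.
by rewrite ler_wpM2l.
Qed.

Lemma closedD X Y : G X -> G Y -> G (fun w => X w + Y w).
Proof.
case: Glin => _ h GX GY.
by have := h 1 _ _ GX GY; under eq_fun do rewrite mul1r.
Qed.

Lemma closedZ l X : G X -> G (fun w => l * X w).
Proof.
case: Glin => G0 h GX.
by have := h l _ _ GX G0; under eq_fun do rewrite addr0.
Qed.

Lemma closedN X : G X -> G (fun w => - X w).
Proof. by move=> /(closedZ (-1)); under eq_fun do rewrite mulN1r. Qed.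

Lemma closed_sqr X : G X -> G (fun w => X w ^+ 2).
Proof.
apply: (@closed_comp (fun x => x ^+ 2) 1) => // x y.
rewrite mul1r subr_sqr normrM mulrC ler_wpM2r //.
by rewrite (le_trans (ler_normD _ _)) // -addrA lerDr.
Qed.

(** Polarization reduces products to squares. *)
Lemma closedM X Y : G X -> G Y -> G (fun w => X w * Y w).
Proof.
move=> GX GY.
have -> : (fun w => X w * Y w) = (fun w =>
    4^-1 * ((X w + Y w) ^+ 2 + - (X w + - Y w) ^+ 2)).
  by apply/funext => w; field.
apply: closedZ; apply: closedD; first exact/closed_sqr/closedD.
exact/closedN/closed_sqr/closedD/closedN.
Qed.

Lemma closed_max0 X : G X -> G (fun w => Num.max (X w) 0).
Proof.
by apply: (@closed_lip (fun x => Num.max x 0) 1) => x y; rewrite mul1r dist_max_le.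
Qed.

End LipschitzClosure.

(** * Conditional expectations *)

Section ConditionalExpectation.
Context {R : realType} {d : measure_display} {Omega : measurableType d}.
Context {H : set (Omega -> R)} {E : (Omega -> R) -> \bar R}.
Context {G : set (Omega -> R)} {EG : (Omega -> R) -> Omega -> R}.
Hypothesis HE : sublinear_expectation_space H E.
Hypothesis HG : rv_subspace H G.
Hypothesis HC : conditional_expectation H E G EG.
Implicit Types (X Y xi : Omega -> R).

(** At exponent 1, [pos_power] is the positive part, so an inequality in L_1 becomes a pointwise one
    with a subnull excess. *)
Lemma le_Lp1_subnull X Y : sl_integrable (E := E) (fun w => X w - Y w) ->
  le_Lp E 1 X Y -> subnull (E := E) (fun w => Num.max (X w - Y w) 0).
Proof.
move=> iXY; have -> : le_Lp E 1 X Y = (E (fun w => Num.max (X w - Y w) 0) = 0%E).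
  rewrite /le_Lp; congr (E _ = _); apply/funext => w.
  by rewrite /pos_power powRr1 // le_max lexx orbT.
move=> h; split; last by rewrite /ev h.
by apply: (sl_integrable_le HE) iXY => w; exact: norm_max0_le.
Qed.

Lemma ce_sl_integrable X : integrable_rv H E X -> sl_integrable (E := E) (EG X).
Proof. by move=> /(ce_maps HC)[]. Qed.

(* The sublinear substitute for [E[xi X | G] = xi E[X | G]]: only [xi >= 0]
   is allowed and only one inequality is claimed, but [xi * (X - EG X)] may
   then be added to any integrable variable without increasing [E]. *)
Lemma subnull_pullout X xi c : integrable_rv H E X -> G xi ->
  (forall w, 0 <= xi w <= c) ->
  subnull (E := E) (fun w => xi w * (X w - EG X w)).
Proof.
move=> iX Gxi xi0.
have [HX iX'] := iX; have iEX := ce_sl_integrable X iX.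
have [GEX _] := ce_maps HC iX.
have [Hlin Hcl] := (sle_linear HE, sle_closed HE).
have [Glin Gcl] := (rvs_linear HG, rvs_closed HG).
have xib w : `|xi w| <= c.
  by case/andP: (xi0 w) => ? ?; rewrite ger0_norm.
have Hxi : H xi by exact: (rvs_sub HG).
have irxi : integrable_rv H E xi.
  by split=> //; exact: (sl_integrable_bounded HE _ c).
have irxiX : integrable_rv H E (fun w => xi w * X w).
  by split; [exact: closedM|exact: (sl_integrable_mulb HE _ _ c)].
(* With eta = - xi EG[X], [ce_add] gives EG[eta + xi X] <= eta + EG[xi X] and [ce_mul] gives
   EG[xi X] <= xi EG[X], so EG[eta + xi X] <= 0, all up to subnull terms. *)
pose eta w := - (xi w * EG X w).
have Geta : G eta by apply: closedN => //; exact: closedM.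
have ieta : sl_integrable (E := E) eta.
  by apply: (sl_integrableN HE); exact: (sl_integrable_mulb HE _ _ c).
have ireta : integrable_rv H E eta by split=> //; exact: (rvs_sub HG).
have irsum : integrable_rv H E (fun w => eta w + xi w * X w).
  split; first by apply: closedD => //; [case: ireta|case: irxiX].
  by apply: (sl_integrableD HE) => //; case: irxiX.
have i1 := ce_sl_integrable _ irsum.
have i2 := ce_sl_integrable _ irxiX.
have [/le_Lp1_subnull n1 _] := ce_add HC ireta irxiX Geta.
have [/le_Lp1_subnull n2 _] := ce_mul HC irxi iX Gxi irxiX.
(* For xi >= 0 the negative part vanishes, and with it the term EG[-X]. *)
have e2 w : xi^\+ w * EG X w + xi^\- w * EG (fun v => - X v) w = xi w * EG X w.
  have /andP[x0 _] := xi0 w.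
  by rewrite /funrpos /funrneg max_l // max_r ?oppr_le0 // mul0r addr0.
have {}n1 := n1 (sl_integrableB HE _ _ i1 (sl_integrableD HE _ _ ieta i2)).
have i3 : sl_integrable (E := E)
    (fun w => xi^\+ w * EG X w + xi^\- w * EG (fun v => - X v) w).
  under eq_fun do rewrite e2.
  exact: (sl_integrable_mulb HE _ _ c).
have {}n2 := n2 (sl_integrableB HE _ _ i2 i3).
have n3 : subnull (E := E) (EG (fun w => eta w + xi w * X w)).
  apply: (subnull_le HE _ _ i1 _ (subnullD HE _ _ n1 n2)) => w.
  rewrite e2; set a := EG _ w; set b := EG (fun v => xi v * X v) w.
  have h1 : a - (eta w + b) <= Num.max (a - (eta w + b)) 0 by rewrite le_max lexx.
  have h2 : b - xi w * EG X w <= Num.max (b - xi w * EG X w) 0.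
    by rewrite le_max lexx.
  by move: h1 h2; rewrite /eta; lra.
have -> : (fun w => xi w * (X w - EG X w)) = (fun w => eta w + xi w * X w).
  by apply/funext => w; rewrite /eta; ring.
(* The tower property transfers the sign from EG[eta + xi X] to eta + xi X. *)
case: n3 => _ h; split; first by case: irsum.
by rewrite /ev -(ce_tower HC irsum).
Qed.

(** Positivity of [EG] is derived here, up to a subnull variable. The natural weight for
    [subnull_pullout], the indicator of EG[X] < 0, is not Lipschitz in EG[X]; min(EG[X]^-, e) / e
    replaces it at a cost of at most e. *)
Lemma subnull_cond_neg X : integrable_rv H E X -> (forall w, 0 <= X w) ->
  subnull (E := E) (fun w => Num.max (- EG X w) 0).
Proof.
move=> iX X0; have iEX := ce_sl_integrable X iX.
have iu : sl_integrable (E := E) (fun w => Num.max (- EG X w) 0).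
  apply: (sl_integrable_le HE) iEX => w.
  by rewrite (le_trans (norm_max0_le _)) // normrN.
split=> //; apply/ler_addgt0Pr => e e0; rewrite add0r.
pose xi w := Num.min (Num.max (- EG X w) 0) e.
have Gxi : G xi.
  apply: (closed_lip (rvs_closed HG) (fun x => Num.min (Num.max (- x) 0) e) 1).
    move=> x y; rewrite mul1r (le_trans (dist_min_le _ _ _)) //.
    by rewrite (le_trans (dist_max_le _ _ _)) // -opprD normrN.
  by case: (ce_maps HC iX).
have xi0 w : 0 <= xi w <= e.
  by rewrite /xi le_min ge_min le_max !lexx !orbT (ltW e0).
have := subnullZ HE e^-1 _ _ (subnull_pullout X xi e iX Gxi xi0).
rewrite invr_ge0 ltW // => /(_ isT) n.
have ie : sl_integrable (E := E) (fun=> e).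
  by apply: (sl_integrable_bounded HE _ `|e|).
rewrite -[leRHS](ev_cst HE).
apply: (ev_le_subnull HE _ _ _ iu n ie) => w.
rewrite /xi; set a := EG X w; have x0 := X0 w.
rewrite -lerBlDr [leRHS]mulrC ler_pdivlMr //.
(* The left side is positive only where -a > e; there [xi] equals e, and X >= 0 suffices. *)
case: (leP (- a) 0) => ha.
  by rewrite min_l ?ltW // mul0r; nra.
by case: (leP (- a) e) => he; nra.
Qed.

End ConditionalExpectation.

(** * Compensated increments of adapted sequences *)

Section AdaptedSequence.
Context {R : realType} {d : measure_display} {Omega : measurableType d}.
Context {H : set (Omega -> R)} {E : (Omega -> R) -> \bar R} {N : nat}.
Context {Hn : nat -> set (Omega -> R)} {En : nat -> (Omega -> R) -> Omega -> R}.
Hypothesis HE : sublinear_expectation_space H E.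
Hypothesis HHn : forall k, (k <= N)%N -> rv_subspace H (Hn k).
Hypothesis Hincr : forall k, (k < N)%N -> Hn k `<=` Hn k.+1.
Hypothesis HEn :
  forall k, (k <= N)%N -> conditional_expectation H E (Hn k) (En k).
Implicit Types Z : nat -> Omega -> R.

Definition adapted Z : Prop := forall k, (1 <= k <= N)%N -> Hn k (Z k).

Definition bounded_by Z (M : R) : Prop :=
  forall k w, (1 <= k <= N)%N -> `|Z k w| <= M.

Let le_pred k : (1 <= k <= N)%N -> (k.-1 <= N)%N.
Proof. by case/andP => _; exact: leq_trans (leq_pred k). Qed.

Lemma adaptedN Z : adapted Z -> adapted (fun k w => - Z k w).
Proof. by move=> aZ k kN; apply: closedN; [case/andP: kN => _ /HHn[]|exact: aZ]. Qed.

Lemma bounded_byN Z M : bounded_by Z M -> bounded_by (fun k w => - Z k w) M.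
Proof. by move=> bZ k w kN; rewrite normrN; exact: bZ. Qed.

Lemma reflected_adapted Z k : adapted Z -> (k <= N)%N ->
  Hn k (fun w => reflected (Z^~ w) k).
Proof.
move=> aZ; elim: k => [|k IH] kN; first exact: rvs_cst (HHn 0%N kN) 0.
have [_ Glin _ Gcl] := HHn k.+1 kN.
apply: closed_max0 => //; apply: closedD => //; last exact: aZ.
by apply: Hincr => //; apply: IH; exact: ltnW.
Qed.

Lemma reflected_bounded Z M k w : 0 <= M -> bounded_by Z M -> (k <= N)%N ->
  0 <= reflected (Z^~ w) k <= 2 * (N%:R * M).
Proof.
move=> M0 bZ kN; rewrite reflected_ge0 /=.
apply: le_trans (reflected_le_max_abs (Z^~ w) N k kN) _.
by rewrite ler_wpM2l // max_abs_bound // => i; exact: bZ.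
Qed.

Lemma lip_integrable_rv Z M k (f : R -> R) L : 0 <= M -> adapted Z ->
  bounded_by Z M -> (1 <= k <= N)%N ->
  (forall x y, `|x| <= M -> `|y| <= M -> `|f x - f y| <= L * `|x - y|) ->
  integrable_rv H E (fun w => f (Z k w)).
Proof.
move=> M0 aZ bZ kN fL; split.
  apply: (closed_lip_on (sle_closed HE) f L (- M) M).
  - by rewrite (le_trans _ M0) // oppr_le0.
  - by move=> w; rewrite -ler_norml; exact: bZ.
  - by move=> x y; rewrite -!ler_norml; exact: fL.
  by apply: (rvs_sub (HHn k _)); [case/andP: kN|exact: aZ].
apply: (sl_integrable_bounded HE _ (`|L| * M + `|f 0|)) => w.
rewrite -[f _](subrK (f 0)) (le_trans (ler_normD _ _)) // lerD2r.
have Zb := bZ k w kN.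
apply: le_trans (fL _ 0 Zb _) _; first by rewrite normr0.
rewrite subr0 (le_trans (ler_wpM2r (normr_ge0 _) (ler_norm L))) //.
by rewrite ler_wpM2l.
Qed.

Lemma id_integrable_rv Z M k : 0 <= M -> adapted Z -> bounded_by Z M ->
  (1 <= k <= N)%N -> integrable_rv H E (Z k).
Proof.
move=> M0 aZ bZ kN; apply: (lip_integrable_rv Z M k id 1) => // x y _ _.
by rewrite mul1r.
Qed.

Lemma sqr_integrable_rv Z M k : 0 <= M -> adapted Z -> bounded_by Z M ->
  (1 <= k <= N)%N -> integrable_rv H E (fun w => Z k w ^+ 2).
Proof.
move=> M0 aZ bZ kN.
apply: (lip_integrable_rv Z M k (fun x => x ^+ 2) (M + M)) => // x y xM yM.
rewrite subr_sqr normrM mulrC ler_wpM2r //.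
by rewrite (le_trans (ler_normD _ _)) // lerD.
Qed.

Lemma powR_integrable_rv Z M k p : 0 <= M -> adapted Z -> bounded_by Z M ->
  (1 <= k <= N)%N -> 2 <= p -> integrable_rv H E (fun w => `|Z k w| `^ p).
Proof.
move=> M0 aZ bZ kN p2.
apply: (lip_integrable_rv Z M k (fun x => `|x| `^ p) (p * M `^ (p - 1))) => //.
move=> x y xM yM; have := powR_lip `|x| `|y| M (p - 1).
rewrite subrK => h; apply: le_trans (h _ _ _) _; rewrite ?normr_ge0 //.
  by lra.
by rewrite ler_wpM2l ?mulr_ge0 ?powR_ge0 ?ler_dist_dist //; lra.
Qed.

(** The step of a martingale transform: the weight [xi] is known at time k - 1 and multiplies a
    variable compensated at that time. *)
Lemma subnull_increment (xi X : Omega -> R) k c : (1 <= k <= N)%N ->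
  integrable_rv H E X -> Hn k.-1 xi -> (forall w, 0 <= xi w <= c) ->
  subnull (E := E) (fun w => xi w * (X w - En k.-1 X w)).
Proof.
move=> kN iX Hxi xib.
exact: (subnull_pullout HE (HHn _ (le_pred k kN)) (HEn _ (le_pred k kN)) X xi c).
Qed.

Lemma subnull_increment1 (X : Omega -> R) k : (1 <= k <= N)%N ->
  integrable_rv H E X ->
  subnull (E := E) (fun w => X w - En k.-1 X w).
Proof.
move=> kN iX.
have := subnull_increment (fun=> 1) X k 1 kN iX (rvs_cst (HHn _ (le_pred k kN)) 1).
by under eq_fun do rewrite mul1r; apply=> w; rewrite ler01 lexx.
Qed.

Lemma cond_sl_integrable X k : (1 <= k <= N)%N -> integrable_rv H E X ->
  sl_integrable (E := E) (En k.-1 X).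
Proof. by move=> /le_pred /HEn hk iX; exact: ce_sl_integrable hk X iX. Qed.

Lemma cond_moment_sum_integrable Z (f : R -> R) :
  (forall k, (1 <= k <= N)%N -> integrable_rv H E (fun w => f (Z k w))) ->
  sl_integrable (E := E) (cond_moment_sum N En Z f).
Proof.
move=> fi; apply: (sl_integrable_sum HE) => k; rewrite mem_index_iota => kN.
exact: cond_sl_integrable (fi k kN).
Qed.

(** A conditional moment may be negative at some points, but the sum of the f(Z_k), which is
    nonnegative, exceeds the sum of the conditional moments by a subnull variable. *)
Lemma cond_moment_sum_ev_ge0 Z (f : R -> R) : (forall x, 0 <= f x) ->
  (forall k, (1 <= k <= N)%N -> integrable_rv H E (fun w => f (Z k w))) ->
  0 <= ev (E := E) (cond_moment_sum N En Z f).
Proof.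
move=> f0 fi; rewrite -(ev_cst HE 0).
have nU : subnull (E := E) (fun w =>
    \sum_(1 <= k < N.+1) (f (Z k w) - En k.-1 (fun v => f (Z k v)) w)).
  apply: (subnull_sum HE) => k; rewrite mem_index_iota => kN.
  exact: subnull_increment1 (fi k kN).
apply: (ev_le_subnull HE _ _ _ _ nU).
- by apply: (sl_integrable_bounded HE _ 0) => w; rewrite normr0.
- exact: cond_moment_sum_integrable.
- by move=> w; rewrite -big_split /=; apply: sumr_ge0 => k _; rewrite subrK.
Qed.

(** [U] collects the compensated Z_k, with the bounded weights 2 R_{k-1}, and the compensated Z_k^2.
    The drift term stays as it is, since the first two inequalities bound it in different ways. *)
Lemma reflected_sq_bound Z M : 0 <= M -> adapted Z -> bounded_by Z M ->
  exists2 U, subnull (E := E) U & forall w,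
    reflected (Z^~ w) N ^+ 2 <= U w +
      (\sum_(1 <= k < N.+1) 2 * reflected (Z^~ w) k.-1 * En k.-1 (Z k) w
       + cond_moment_sum N En Z (fun z => z ^+ 2) w).
Proof.
move=> M0 aZ bZ.
exists (fun w => \sum_(1 <= k < N.+1)
  (2 * (reflected (Z^~ w) k.-1 * (Z k w - En k.-1 (Z k) w))
   + (Z k w ^+ 2 - En k.-1 (fun v => Z k v ^+ 2) w))).
  apply: (subnull_sum HE) => k; rewrite mem_index_iota => kN.
  apply: (subnullD HE).
    apply: (subnullZ HE) => //.
    apply: (subnull_increment _ _ k (2 * (N%:R * M))) => //.
    - exact: id_integrable_rv bZ kN.
    - by apply: reflected_adapted => //; exact: le_pred.
    - by move=> w; apply: reflected_bounded => //; exact: le_pred.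
  apply: subnull_increment1 => //; exact: sqr_integrable_rv bZ kN.
move=> w; apply: le_trans (reflected_sq_le _ _) _.
rewrite /cond_moment_sum -!big_split /= le_eqVlt; apply/orP; left; apply/eqP.
by apply: eq_bigr => k _; ring.
Qed.

(** [powR_compensated_step] is summed over k. [U] holds the weighted compensated Z_k, Z_k^2 and
    |Z_k|^p and the negative parts of the conditional second moments, all subnull. *)
Lemma reflected_powR_bound Z M p e : 0 <= M -> adapted Z -> bounded_by Z M ->
  2 <= p -> 0 < e ->
  exists2 U, subnull (E := E) U & forall w,
    let s := Num.max (2 * max_abs (Z^~ w) N) e in
    reflected (Z^~ w) N `^ p <= U w +
      (p * s `^ (p - 1) * (\sum_(1 <= k < N.+1) (En k.-1 (Z k))^\+ w)
       + taylor_const p * (s `^ (p - 2) *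
            cond_moment_sum N En Z (fun z => z ^+ 2) w
          + cond_moment_sum N En Z (fun z => `|z| `^ p) w)).
Proof.
move=> M0 aZ bZ p2 e0.
have p10 : 0 <= p - 1 by lra.
have p20 : 0 <= p - 2 by lra.
have p0 : 0 <= p by lra.
have K0 : 0 <= taylor_const p by apply: le_trans (taylor_const_ge p p2).
set K := taylor_const p.
(* One constant that bounds [e], every R_{k-1} and the [s] of the conclusion. *)
pose c := 2 * (N%:R * M) + e.
have c0 : 0 < c by rewrite ltr_wpDl // !mulr_ge0.
pose rf k w := reflected (Z^~ w) k.-1.
pose xi k w := Num.max (rf k w) e `^ (p - 2).
pose v k := En k.-1 (fun v => Z k v ^+ 2).
have ec : e <= c by rewrite /c lerDr !mulr_ge0.
have rb k w : (1 <= k <= N)%N -> 0 <= rf k w <= 2 * (N%:R * M).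
  by move=> kN; apply: reflected_bounded => //; exact: le_pred.
have rc k w : (1 <= k <= N)%N -> 0 <= rf k w <= c.
  by move=> /(rb k w)/andP[? ?]; apply/andP; split=> //; rewrite /c; lra.
have rHn k : (1 <= k <= N)%N -> Hn k.-1 (rf k).
  by move=> kN; apply: reflected_adapted => //; exact: le_pred.
exists (fun w => \sum_(1 <= k < N.+1)
  (p * (rf k w `^ (p - 1) * (Z k w - En k.-1 (Z k) w))
   + K * (xi k w * (Z k w ^+ 2 - v k w)
     + ((`|Z k w| `^ p - En k.-1 (fun v => `|Z k v| `^ p) w)
     + c `^ (p - 2) * Num.max (- v k w) 0)))).
  apply: (subnull_sum HE) => k; rewrite mem_index_iota => kN.
  have Hk := HHn _ (le_pred k kN).
  have iZ2 := sqr_integrable_rv Z M k M0 aZ bZ kN.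
  apply: (subnullD HE); apply: (subnullZ HE) => //.
    apply: (subnull_increment _ _ k (c `^ (p - 1))) => //.
    - exact: id_integrable_rv bZ kN.
    - apply: (closed_lip_on (rvs_closed Hk) (fun x => x `^ (p - 1))
        ((p - 2 + 1) * c `^ (p - 2)) 0 c) (rHn k kN); rewrite ?ltW //.
        by move=> w; exact: rc.
      by rewrite (_ : p - 1 = p - 2 + 1); [move=> x y; exact: powR_lip|ring].
    - move=> w; have /andP[r0 rcw] := rc k w kN.
      by rewrite powR_ge0 powR_le.
  apply: (subnullD HE).
    apply: (subnull_increment _ _ k (c `^ (p - 2))) => //.
    - apply: (closed_lip_on (rvs_closed Hk) (fun x => Num.max x e `^ (p - 2))
        ((p - 2 + 1) * c `^ (p - 2) / e) 0 c) (rHn k kN); rewrite ?ltW //.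
        by move=> w; exact: rc.
      move=> x y /andP[_ xc] /andP[_ yc]; exact: powR_max_lip.
    - move=> w; have /andP[r0 rcw] := rc k w kN.
      rewrite powR_ge0 powR_le // ?ge_max ?rcw //.
      by rewrite le_max r0.
  apply: (subnullD HE).
    apply: subnull_increment1 => //; exact: powR_integrable_rv bZ kN p2.
  apply: (subnullZ HE) => //; first exact: powR_ge0.
  apply: (subnull_cond_neg HE Hk (HEn _ (le_pred k kN))) => // w.
  exact: sqr_ge0.
move=> w /=; set s := Num.max _ e.
apply: le_trans (reflected_powR_le _ _ _ p2) _.
rewrite /cond_moment_sum -mulrA !mulr_sumr -!big_split /= mulr_sumr -!big_split /=.
rewrite big_seq [leRHS]big_seq; apply: ler_sum => k; rewrite mem_index_iota => kN.
have [r0 _] := andP (rb k w kN).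
have rs : rf k w <= 2 * max_abs (Z^~ w) N.
  by apply: reflected_le_max_abs; exact: le_pred.
apply: powR_compensated_step => //.
- by rewrite /s le_max rs.
- by rewrite /s le_max lexx orbT.
- rewrite /s ge_max; apply/andP; split; last by [].
  apply: (@le_trans _ _ (2 * (N%:R * M))); last by rewrite /c lerDl ltW.
  by rewrite ler_wpM2l // max_abs_bound // => i; exact: bZ.
Qed.

End AdaptedSequence.

(** * Maximal inequalities *)

Section RosenthalConstant.
Context {R : realType}.
Implicit Types p s e u v r : R.

(* The bases [4 * 2 `^ p * 2 `^ p * p] and [8 * 2 `^ p * 2 `^ p * taylor_const p]
   are the inverses of the weights in Young's inequality for which the two
   terms in [Num.max (2 * S) e `^ p] add up to at most
   [(S `^ p + e `^ p) / 2]. *)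
Definition drift_const p : R :=
  2 * 2 `^ p * p * (4 * 2 `^ p * 2 `^ p * p) `^ (p - 1).

Definition variance_const p : R :=
  4 * 2 `^ p * taylor_const p *
  (8 * 2 `^ p * 2 `^ p * taylor_const p) `^ ((p - 2) / 2).

Definition moment_const p : R := 4 * 2 `^ p * taylor_const p.

Definition rosenthal_const p : R :=
  drift_const p + variance_const p + moment_const p.

Lemma drift_const_ge0 p : 2 <= p -> 0 <= drift_const p.
Proof. by move=> p2; rewrite !mulr_ge0 ?powR_ge0 //; lra. Qed.

Lemma taylor_const_gt0 p : 2 <= p -> 0 < taylor_const p.
Proof. by move=> p2; have := taylor_const_ge p p2; lra. Qed.

Lemma variance_const_ge0 p : 2 <= p -> 0 <= variance_const p.
Proof.
move=> p2; have K := ltW (taylor_const_gt0 p p2).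
by rewrite !mulr_ge0 ?powR_ge0.
Qed.

Lemma moment_const_gt0 p : 2 <= p -> 0 < moment_const p.
Proof.
by move=> p2; have K := taylor_const_gt0 p p2; rewrite !mulr_gt0 ?powR_gt0.
Qed.

Lemma rosenthal_const_gt0 p : 2 <= p -> 0 < rosenthal_const p.
Proof.
move=> p2; rewrite ltr_wpDl ?moment_const_gt0 // addr_ge0 //.
  exact: drift_const_ge0.
exact: variance_const_ge0.
Qed.

(** Insert the two bounds into S^p <= 2^p (r1^p + r2^p). By Young's inequality the drift and
    variance terms cost s^p / (4 2^p) each, at most (S^p + e^p) / 2 together; moving S^p / 2 to the
    left doubles the other terms. *)
Lemma rosenthal_absorb p S r1 r2 u1 u2 A1 A2 V W e :
  let s := Num.max (2 * S) e in
  2 <= p -> 0 <= S -> 0 <= A1 -> 0 <= A2 -> 0 < e -> 0 <= r1 -> 0 <= r2 ->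
  S <= 2 * Num.max r1 r2 ->
  r1 `^ p <= u1 + (p * s `^ (p - 1) * A1
                   + taylor_const p * (s `^ (p - 2) * V + W)) ->
  r2 `^ p <= u2 + (p * s `^ (p - 1) * A2
                   + taylor_const p * (s `^ (p - 2) * V + W)) ->
  S `^ p <= 2 * 2 `^ p * (u1 + u2)
    + (drift_const p * (A1 + A2) `^ p + variance_const p * pos_power V (p / 2)
       + moment_const p * W + e `^ p).
Proof.
move=> s p2 S0 A10 A20 e0 r10 r20 Sr b1 b2.
have p0 : 0 < p by lra.
have K0 := taylor_const_gt0 p p2.
have T0 : 0 < 2 `^ p :> R by rewrite powR_gt0.
have T1 : 1 <= 2 `^ p :> R.
  by have := powR_le 1 2 p; rewrite powR1; apply; lra.
have s0 : 0 <= s by rewrite /s le_max (ltW e0) orbT.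
have sp : s `^ p <= 2 `^ p * S `^ p + e `^ p.
  rewrite /s; have := powR_ge0 e p; have := powR_ge0 S p.
  case: (leP (2 * S) e) => _ S' e'; first by rewrite lerDr mulr_ge0 // ltW.
  by rewrite powRM // lerDl.
have Sp : S `^ p <= 2 `^ p * (r1 `^ p + r2 `^ p).
  apply: le_trans (powR_le _ _ _ (ltW p0) S0 Sr) _.
  rewrite powRM ?le_max ?r10 // ler_wpM2l ?powR_ge0 //.
  have := powR_ge0 r1 p; have := powR_ge0 r2 p.
  by case: (leP r1 r2) => _; lra.
(* [V] may be negative, so Young's inequality is applied to its positive part, as in [pos_power]. *)
have V0 : 0 <= Num.max V 0 by rewrite le_max lexx orbT.
have VV : V <= Num.max V 0 by rewrite le_max lexx.
pose dA := (4 * 2 `^ p * 2 `^ p * p)^-1 : R.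
pose dV := (8 * 2 `^ p * 2 `^ p * taylor_const p)^-1 : R.
have dA0 : 0 < dA by rewrite invr_gt0 !mulr_gt0.
have dV0 : 0 < dV by rewrite invr_gt0 !mulr_gt0.
have yA := young_eps_l s (A1 + A2) dA p _ dA0 s0 (addr_ge0 A10 A20).
have {}yA := yA ltac:(lra).
have yV := young_eps_q s (Num.max V 0) dV p p2 dV0 s0 V0.
have hA : 2 `^ p * p * (s `^ (p - 1) * (A1 + A2)) <=
    s `^ p / (4 * 2 `^ p) + drift_const p / 2 * (A1 + A2) `^ p.
  have -> : s `^ p / (4 * 2 `^ p) + drift_const p / 2 * (A1 + A2) `^ p =
      2 `^ p * p * (dA * s `^ p + dA^-1 `^ (p - 1) * (A1 + A2) `^ p);
    last by rewrite ler_wpM2l // ltW // mulr_gt0.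
  by rewrite /dA invrK /drift_const; field; rewrite ?gt_eqF.
have hV : 2 `^ p * (2 * taylor_const p) * (s `^ (p - 2) * V) <=
    s `^ p / (4 * 2 `^ p) + variance_const p / 2 * pos_power V (p / 2).
  apply: (@le_trans _ _ (2 `^ p * (2 * taylor_const p) *
      (s `^ (p - 2) * Num.max V 0))).
    by rewrite ler_wpM2l ?ler_wpM2l ?powR_ge0 // ltW // !mulr_gt0.
  have -> : s `^ p / (4 * 2 `^ p) + variance_const p / 2 * pos_power V (p / 2) =
      2 `^ p * (2 * taylor_const p) *
      (dV * s `^ p + dV^-1 `^ ((p - 2) / 2) * Num.max V 0 `^ (p / 2));
    last by rewrite ler_wpM2l // ltW // !mulr_gt0.
  by rewrite /dV invrK /variance_const /pos_power; field; rewrite ?gt_eqF.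
have hs : s `^ p / (4 * 2 `^ p) <= S `^ p / 4 + e `^ p / 4.
  have := powR_ge0 e p; move: sp T0 T1.
  move: (2 `^ p) (s `^ p) (S `^ p) (e `^ p) => T x y q sp T0 T1 q0.
  rewrite ler_pdivrMr ?mulr_gt0 //; nra.
have hb : 2 `^ p * (r1 `^ p + r2 `^ p) <= 2 `^ p *
  (u1 + (p * s `^ (p - 1) * A1 + taylor_const p * (s `^ (p - 2) * V + W))
   + (u2 + (p * s `^ (p - 1) * A2 + taylor_const p * (s `^ (p - 2) * V + W)))).
  by rewrite ler_wpM2l ?powR_ge0 // lerD.
rewrite /moment_const.
lra.
Qed.

End RosenthalConstant.

(** * Pathwise bounds and their expectations *)

Section MaximalInequalities.
Context {R : realType} {d : measure_display} {Omega : measurableType d}.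
Context {H : set (Omega -> R)} {E : (Omega -> R) -> \bar R} {N : nat}.
Context {Hn : nat -> set (Omega -> R)} {En : nat -> (Omega -> R) -> Omega -> R}.
Context {Z : nat -> Omega -> R} {M : R}.
Hypothesis HE : sublinear_expectation_space H E.
Hypothesis HHn : forall k, (k <= N)%N -> rv_subspace H (Hn k).
Hypothesis Hincr : forall k, (k < N)%N -> Hn k `<=` Hn k.+1.
Hypothesis HEn :
  forall k, (k <= N)%N -> conditional_expectation H E (Hn k) (En k).
Hypotheses (M0 : 0 <= M) (aZ : adapted (Hn := Hn) (N := N) Z).
Hypothesis bZ : bounded_by (N := N) Z M.

Let sqr_iZ k (kN : (1 <= k <= N)%N) := sqr_integrable_rv HE HHn Z M k M0 aZ bZ kN.

Let Zneg : nat -> Omega -> R := fun k w => - Z k w.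
Let aZneg : adapted (Hn := Hn) (N := N) Zneg := adaptedN HHn Z aZ.
Let bZneg : bounded_by (N := N) Zneg M := bounded_byN Z M bZ.

(** The negative part of the lower conditional expectation of Z_k is the positive part of the upper
    one of -Z_k, so the drift sum splits into one share for each reflected walk. *)
Lemma cond_drift_sumE w : cond_drift_sum N En Z w =
  \sum_(1 <= k < N.+1) (En k.-1 (Z k))^\+ w
  + \sum_(1 <= k < N.+1) (En k.-1 (Zneg k))^\+ w.
Proof.
rewrite /cond_drift_sum -big_split /=; apply: eq_bigr => k _.
by rewrite /lower_cond /funrneg opprK.
Qed.

Lemma cond_moment_sum_neg (f : R -> R) : (forall x, f (- x) = f x) ->
  cond_moment_sum N En Zneg f = cond_moment_sum N En Z f.
Proof.
move=> fN; apply/funext => w; apply: eq_bigr => k _; congr (En _ _ w).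
by apply/funext => v; rewrite /Zneg fN.
Qed.

Lemma sum_funrpos_ge0 (X : nat -> Omega -> R) w :
  0 <= \sum_(1 <= k < N.+1) (X k)^\+ w.
Proof. by apply: sumr_ge0 => k _; rewrite /funrpos le_max lexx orbT. Qed.

Lemma sum_reflected_drift_le (z : nat -> R) (X : nat -> Omega -> R) w :
  \sum_(1 <= k < N.+1) 2 * reflected z k.-1 * X k w
    <= 4 * max_abs z N * \sum_(1 <= k < N.+1) (X k)^\+ w.
Proof.
rewrite mulr_sumr big_seq [leRHS]big_seq; apply: ler_sum => k.
rewrite mem_index_iota => /andP[_ kN].
have r0 := reflected_ge0 z k.-1.
have rs : reflected z k.-1 <= 2 * max_abs z N.
  by apply: reflected_le_max_abs; exact: leq_trans (leq_pred k) kN.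
by rewrite /funrpos; case: (leP (X k w) 0) => x0; nra.
Qed.

Lemma max_sq_pathwise : exists2 U, subnull (E := E) U & forall w,
  max_abs (Z^~ w) N ^+ 2 <= U w + (256 * cond_drift_sum N En Z w ^+ 2
     + 16 * cond_moment_sum N En Z (fun z => z ^+ 2) w).
Proof.
have [U1 nU1 h1] := reflected_sq_bound HE HHn Hincr HEn Z M M0 aZ bZ.
have [U2 nU2 h2] := reflected_sq_bound HE HHn Hincr HEn Zneg M M0 aZneg bZneg.
exists (fun w => 8 * (U1 w + U2 w)).
  by apply: (subnullZ HE) => //; exact: (subnullD HE).
move=> w; have {}h1 := h1 w; have {}h2 := h2 w.
rewrite cond_moment_sum_neg in h2; last by move=> x; rewrite sqrrN.
have g1 := sum_reflected_drift_le (Z^~ w) (fun k => En k.-1 (Z k)) w.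
have g2 := sum_reflected_drift_le (Zneg^~ w) (fun k => En k.-1 (Zneg k)) w.
rewrite max_absN in g2.
have ms : max_abs (Z^~ w) N <=
    2 * Num.max (reflected (Z^~ w) N) (reflected (Zneg^~ w) N).
  exact: max_abs_le_reflected.
have s0 := max_abs_ge0 (Z^~ w) N.
have r1 := reflected_ge0 (Z^~ w) N; have r2 := reflected_ge0 (Zneg^~ w) N.
rewrite cond_drift_sumE.
set S := max_abs _ N in g1 g2 ms s0 *.
set A1 := \sum_(1 <= k < N.+1) (En k.-1 (Z k))^\+ w in g1 *.
set A2 := \sum_(1 <= k < N.+1) (En k.-1 (Zneg k))^\+ w in g2 *.
set V := cond_moment_sum _ _ _ _ _ in h1 h2 *.
have S2 : S ^+ 2 <= 4 * (reflected (Z^~ w) N ^+ 2 + reflected (Zneg^~ w) N ^+ 2).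
  move: ms; case: (leP (reflected (Z^~ w) N) _) => _ ms; nra.
(* The bounds above combine to S^2 <= 4 (U1 + U2) + 16 S A + 8 V with A = A1 + A2. The square gives
   16 S A <= S^2 / 2 + 128 A^2, and doubling yields the factors 256 and 16. *)
have := sqr_ge0 (S - 16 * (A1 + A2)).
lra.
Qed.

Lemma max_powR_pathwise p e : 2 <= p -> 0 < e ->
  exists2 U, subnull (E := E) U & forall w,
  max_abs (Z^~ w) N `^ p <= U w + (drift_const p * cond_drift_sum N En Z w `^ p
     + variance_const p *
         pos_power (cond_moment_sum N En Z (fun z => z ^+ 2) w) (p / 2)
     + moment_const p * cond_moment_sum N En Z (fun z => `|z| `^ p) w
     + e `^ p).
Proof.
move=> p2 e0.
have [U1 nU1 h1] := reflected_powR_bound HE HHn Hincr HEn Z M p e M0 aZ bZ p2 e0.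
have [U2 nU2 h2] :=
  reflected_powR_bound HE HHn Hincr HEn Zneg M p e M0 aZneg bZneg p2 e0.
exists (fun w => 2 * 2 `^ p * (U1 w + U2 w)).
  by apply: (subnullZ HE); [rewrite mulr_ge0 ?powR_ge0|exact: (subnullD HE)].
move=> w; have {}h1 := h1 w; have {}h2 := h2 w.
rewrite /= max_absN !cond_moment_sum_neg in h2; first last.
- by move=> x; rewrite sqrrN.
- by move=> x; rewrite normrN.
rewrite cond_drift_sumE; apply: rosenthal_absorb h1 h2 => //.
- exact: max_abs_ge0.
- exact: sum_funrpos_ge0.
- exact: sum_funrpos_ge0.
- exact: reflected_ge0.
- exact: reflected_ge0.
- exact: max_abs_le_reflected.
Qed.

Lemma partial_max_le (f : R -> R) w : (forall x, 0 <= f x) ->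
  {in Num.nneg &, {homo f : x y / x <= y}} ->
  \big[Num.max/0]_(0 <= k < N.+1) f `|partial_sum Z k w|
    <= f (max_abs (Z^~ w) N).
Proof.
move=> f0 fle; rewrite big_seq; apply: bigmax_le => // k.
rewrite mem_index_iota ltnS => kN; apply: fle; rewrite ?nnegrE //.
  exact: max_abs_ge0.
exact: (max_abs_ge (Z^~ w)).
Qed.

Lemma max_abs_integrable (f : R -> R) : (forall x, 0 <= f x) ->
  {in Num.nneg &, {homo f : x y / x <= y}} ->
  sl_integrable (E := E) (fun w => f (max_abs (Z^~ w) N)).
Proof.
move=> f0 fle; apply: (sl_integrable_bounded HE _ (f (N%:R * M))) => w.
rewrite ger0_norm //; apply: fle; rewrite ?nnegrE ?max_abs_ge0 ?mulr_ge0 //.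
by apply: max_abs_bound => // k kN; exact: bZ.
Qed.

Lemma supermartingale_max_sq :
  (forall k, (1 <= k <= N)%N -> le_Lp E 1 (En k.-1 (Z k)) (fun=> 0)) ->
  (E (fun w => (\big[Num.max/0]_(0 <= k < N.+1)
                 (partial_sum Z N w - partial_sum Z k w)) ^+ 2)%R
    <= E (cond_moment_sum N En Z (fun z => z ^+ 2)%R))%E.
Proof.
move=> drift.
have iV := cond_moment_sum_integrable HE HEn Z (fun z => z ^+ 2) sqr_iZ.
have [U nU hU] := reflected_sq_bound HE HHn Hincr HEn Z M M0 aZ bZ.
have rb w : 0 <= reflected (Z^~ w) N <= 2 * (N%:R * M).
  exact: reflected_bounded.
have iR : sl_integrable (E := E) (fun w => reflected (Z^~ w) N ^+ 2).
  apply: (sl_integrable_bounded HE _ ((2 * (N%:R * M)) ^+ 2)) => w.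
  have /andP[? ?] := rb w.
  by rewrite ger0_norm ?sqr_ge0 // lerXn2r // nnegrE // !mulr_ge0.
apply: (@le_trans _ _ (E (fun w => reflected (Z^~ w) N ^+ 2)%R)).
  apply: (sle_le HE) => w.
  rewrite lerXn2r // ?nnegrE ?bigmax_ge_id ?reflected_ge0 //.
  rewrite big_seq; apply: bigmax_le => [|k]; first exact: reflected_ge0.
  by rewrite mem_index_iota ltnS => kN; exact: (reflected_ge (Z^~ w)).
rewrite !(evE HE) // lee_fin.
(* The drift is nonpositive only in L_1. Its positive part is subnull, and 4 N M bounds the weight 2
   R_{k-1} in front of it. *)
have nD : subnull (E := E) (fun w => \sum_(1 <= k < N.+1)
    4 * (N%:R * M) * Num.max (En k.-1 (Z k) w - 0) 0).
  apply: (subnull_sum HE) => k; rewrite mem_index_iota => kN.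
  apply: (subnullZ HE); first by rewrite !mulr_ge0.
  apply: (le_Lp1_subnull HE); last exact: drift.
  under eq_fun do rewrite subr0.
  apply: (cond_sl_integrable HEn (Z k) k kN).
  exact: (id_integrable_rv HE HHn Z M k M0 aZ bZ kN).
apply: (ev_le_subnull HE _ _ _ iR (subnullD HE _ _ nU nD) iV) => w.
apply: le_trans (hU w) _; rewrite -addrA lerD2l lerD2r.
rewrite big_seq [leRHS]big_seq; apply: ler_sum => k; rewrite mem_index_iota => kN.
have /andP[r0 rc] : 0 <= reflected (Z^~ w) k.-1 <= 2 * (N%:R * M).
  apply: reflected_bounded => //.
  by case/andP: kN => _; exact: leq_trans (leq_pred k).
by rewrite subr0; case: (leP (En k.-1 (Z k) w) 0) => ?; nra.
Qed.

Lemma max_sq_le :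
  (E (fun w => \big[Num.max/0]_(0 <= k < N.+1) (`|partial_sum Z k w| ^+ 2))%R
    <= (256 : R)%:E * (E (cond_moment_sum N En Z (fun z => z ^+ 2)%R)
                       + E (fun w => (cond_drift_sum N En Z w) ^+ 2)%R))%E.
Proof.
have iV := cond_moment_sum_integrable HE HEn Z (fun z => z ^+ 2) sqr_iZ.
have V0 := cond_moment_sum_ev_ge0 HE HHn HEn Z _ (@sqr_ge0 R) sqr_iZ.
have sq_homo : {in Num.nneg &, {homo (fun x : R => x ^+ 2) : x y / x <= y}}.
  by move=> x y x0 y0 xy; rewrite lerXn2r.
have iS := max_abs_integrable _ (@sqr_ge0 R) sq_homo.
have [U nU hU] := max_sq_pathwise.
apply: (@le_trans _ _ (E (fun w => max_abs (Z^~ w) N ^+ 2)%R)).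
  by apply: (sle_le HE) => w; exact: partial_max_le (@sqr_ge0 R) sq_homo.
rewrite (evE HE _ iV).
(* [ce_maps] gives first moments only, so the squared drift sum may have infinite expectation; the
   right side is then +oo. *)
have [iA|->] := sl_integrable_or_pinfty (E := E)
  (fun w => cond_drift_sum N En Z w ^+ 2)
  (fun w => sqr_ge0 _); last by rewrite addey // mulry gtr0_sg // mul1e leey.
rewrite !(evE HE) // -EFinD -EFinM lee_fin.
have i1 := sl_integrableZ HE 256 _ iA; have i2 := sl_integrableZ HE 16 _ iV.
apply: le_trans (ev_le_subnull HE _ _ _ iS nU (sl_integrableD HE _ _ i1 i2) hU) _.
apply: le_trans (evD HE _ _ i1 i2) _.
(* [V0] allows the factor 16 of the variance sum to be raised to 256. *)
have := evZ HE 256 _ (ler0n _ _) iA; have := evZ HE 16 _ (ler0n _ _) iV.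
lra.
Qed.

Lemma max_powR_le p : 2 <= p ->
  (E (fun w => \big[Num.max/0]_(0 <= k < N.+1) (`|partial_sum Z k w| `^ p))%R
    <= (rosenthal_const p)%:E *
       (E (cond_moment_sum N En Z (fun z => `|z| `^ p)%R)
        + E (fun w => pos_power
               (cond_moment_sum N En Z (fun z => z ^+ 2) w) (p / 2))%R
        + E (fun w => (cond_drift_sum N En Z w) `^ p)%R))%E.
Proof.
move=> p2; have p0 : 0 < p by lra.
have iWk k (kN : (1 <= k <= N)%N) := powR_integrable_rv HE HHn Z M k p M0 aZ bZ kN p2.
have iW := cond_moment_sum_integrable HE HEn Z (fun z => `|z| `^ p) iWk.
have W0 := cond_moment_sum_ev_ge0 HE HHn HEn Z _ (fun x => powR_ge0 `|x| p) iWk.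
have pw_homo : {in Num.nneg &, {homo (fun x : R => x `^ p) : x y / x <= y}}.
  by move=> x y x0 y0 xy; rewrite powR_le // ltW.
have pw_ge0 (x : R) : 0 <= x `^ p := powR_ge0 x p.
have iS := max_abs_integrable _ pw_ge0 pw_homo.
have C0 := rosenthal_const_gt0 p p2.
pose Vp w := pos_power (cond_moment_sum N En Z (fun z => z ^+ 2) w) (p / 2).
pose Ap w := cond_drift_sum N En Z w `^ p.
have Vp0 w : 0 <= Vp w by exact: powR_ge0.
have Ap0 w : 0 <= Ap w by exact: powR_ge0.
apply: (@le_trans _ _ (E (fun w => max_abs (Z^~ w) N `^ p)%R)).
  by apply: (sle_le HE) => w; exact: partial_max_le pw_ge0 pw_homo.
rewrite (evE HE _ iW) -/Vp -/Ap.
(* On the right only the first expectation is known to be finite; if another is infinite the bound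
   is trivial. *)
have inf_le : (E (fun w => max_abs (Z^~ w) N `^ p)%R <=
    (rosenthal_const p)%:E * +oo)%E by rewrite mulry gtr0_sg // mul1e leey.
have [iV|EV] := sl_integrable_or_pinfty (E := E) Vp Vp0; last first.
  by rewrite EV addey // addye // gt_eqF // (lt_le_trans _ (sle_ge0 HE Ap Ap0)) ?ltNy0.
have [iA|EA] := sl_integrable_or_pinfty (E := E) Ap Ap0; last first.
  by rewrite EA addey // (evE HE _ iV).
rewrite !(evE HE) // -!EFinD -EFinM lee_fin.
apply/ler_addgt0Pr => eta eta0.
(* Chosen so that the error e^p is the arbitrary [eta]. *)
pose e := eta `^ p^-1.
have ep : e `^ p = eta by rewrite /e -powRrM mulVf ?gt_eqF // powRr1 // ltW.
have [U nU hU] := max_powR_pathwise p e p2 (powR_gt0 _ eta0).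
rewrite ep in hU.
have i1 := sl_integrableZ HE (drift_const p) _ iA.
have i2 := sl_integrableZ HE (variance_const p) _ iV.
have i3 := sl_integrableZ HE (moment_const p) _ iW.
have i12 := sl_integrableD HE _ _ i1 i2.
have i123 := sl_integrableD HE _ _ i12 i3.
have ie : sl_integrable (E := E) (fun=> eta).
  by apply: (sl_integrable_bounded HE _ `|eta|).
apply: le_trans (ev_le_subnull HE _ _ _ iS nU (sl_integrableD HE _ _ i123 ie) hU) _.
apply: le_trans (evD HE _ _ i123 ie) _; rewrite (ev_cst HE) lerD2r.
apply: le_trans (evD HE _ _ i12 i3) _.
have h12 := evD HE _ _ i1 i2.
have c1 := drift_const_ge0 p p2; have c2 := variance_const_ge0 p p2.
have c3 := ltW (moment_const_gt0 p p2).
have e1 := evZ HE _ _ c1 iA; have e2 := evZ HE _ _ c2 iV.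
have e3 := evZ HE _ _ c3 iW.
have eA := ev_ge0 HE _ iA Ap0; have eV := ev_ge0 HE _ iV Vp0.
(* Each of the three constants is at most their sum, and the three expectations are nonnegative. *)
rewrite /rosenthal_const; nra.
Qed.

End MaximalInequalities.

(* Every maximum below is over values that are >= 0 or include 0 (index k = N
   in the first, k = 0 in the others), so its seed 0 adds nothing. *)
Theorem theorem4p1 (R : realType) :
  exists C : R -> R,
  forall (d : measure_display) (Omega : measurableType d)
    (H : set (Omega -> R)) (E : (Omega -> R) -> \bar R)
    (N : nat) (Hn : nat -> set (Omega -> R))
    (En : nat -> (Omega -> R) -> Omega -> R)
    (Z : nat -> Omega -> R),
  sublinear_expectation_space H E ->
  (forall k, (k <= N)%N -> rv_subspace H (Hn k)) ->
  (forall k, (k < N)%N -> Hn k `<=` Hn k.+1) ->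
  (forall k, (k <= N)%N -> conditional_expectation H E (Hn k) (En k)) ->
  (forall k, (1 <= k <= N)%N -> Hn k (Z k)) ->
  (exists M : R, forall k w, (1 <= k <= N)%N -> `|Z k w| <= M) ->
  [/\ (forall k, (1 <= k <= N)%N -> le_Lp E 1 (En k.-1 (Z k)) (fun=> 0)) ->
      (E (fun w => (\big[Num.max/0]_(0 <= k < N.+1)
                     (partial_sum Z N w - partial_sum Z k w)) ^+ 2)%R
        <= E (cond_moment_sum N En Z (fun z => z ^+ 2)%R))%E,
      (E (fun w => \big[Num.max/0]_(0 <= k < N.+1)
                     (`|partial_sum Z k w| ^+ 2))%R
        <= (256 : R)%:E *
           (E (cond_moment_sum N En Z (fun z => z ^+ 2)%R)
            + E (fun w => (cond_drift_sum N En Z w) ^+ 2)%R))%E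
    & forall p : R, 2 <= p ->
      (E (fun w => \big[Num.max/0]_(0 <= k < N.+1)
                     (`|partial_sum Z k w| `^ p))%R
        <= (C p)%:E *
           (E (cond_moment_sum N En Z (fun z => `|z| `^ p)%R)
            + E (fun w => pos_power
                   (cond_moment_sum N En Z (fun z => z ^+ 2) w) (p / 2))%R
            + E (fun w => (cond_drift_sum N En Z w) `^ p)%R))%E ].
Proof.
exists rosenthal_const => d Omega H E N Hn En Z HE HHn Hincr HEn aZ [M bZ].
(* The given [M] may be negative, for instance when [N] is 0. *)
have bZ' : bounded_by (N := N) Z `|M|.
  by move=> k w kN; apply: le_trans (bZ k w kN) (ler_norm M).
have M0 := normr_ge0 M.
split.
- exact: supermartingale_max_sq HE HHn Hincr HEn M0 aZ bZ'.
- exact: max_sq_le HE HHn Hincr HEn M0 aZ bZ'.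
- by move=> p; exact: max_powR_le HE HHn Hincr HEn M0 aZ bZ' p.
Qed.
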